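(* There is an absolute constant $C>0$ such that for every $n\ge 1$ and every isotropic log-concave random vector $X$ in $\mathbb{R}^n$, $$\Gamma(X)\leq C n^2.$$
   Context: $B_2^n$ is the closed Euclidean unit ball in $\mathbb{R}^n$. For a measure $\mu$ on $\mathbb{R}^n$ and a convex set $Q\subset\mathbb{R}^n$, the $\mu$-perimeter of $Q$ is $$\mu^+(\partial Q)=\liminf_{\epsilon\to +0}\frac{\mu((Q+\epsilon B_2^n)\setminus Q)}{\epsilon}.$$ For a random vector $X$ with distribution $\mu$, $\Gamma(X)=\Gamma(\mu)=\sup_Q \mu^+(\partial Q)$, where the supremum runs over all convex sets $Q$ in $\mathbb{R}^n$. A measure $\mu$ is log-concave if $\mu(\lambda A+(1-\lambda)B)\geq \mu(A)^{\lambda}\mu(B)^{1-\lambda}$ for all Borel sets $A,B\subset\mathbb{R}^n$ and all $\lambda\in[0,1]$. A probability measure is isotropic if its barycenter is the origin and its covariance matrix is the identity. A random vector is called isotropic, log-concave if its distribution is. *)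

(* Defs.v *)
From HB Require Import structures.
From mathcomp Require Import all_boot all_order all_algebra.
From mathcomp Require Import all_classical all_reals all_analysis.
Set Implicit Arguments.
Unset Strict Implicit.
Unset Printing Implicit Defensive.
Import Order.TTheory GRing.Theory Num.Theory.
Import numFieldNormedType.Exports.
Local Open Scope classical_set_scope.
Local Open Scope ring_scope.

(* R^n with its Borel sigma-algebra. *)
Notation borel_rV R n := (g_sigma_algebraType (@open 'rV[R]_n)).

(* The norm the library puts on row vectors is the sup norm, hence the explicit
   Euclidean norm here. *)
Definition euclidean_ball (R : realType) (n : nat) : set 'rV[R]_n :=
  [set x : 'rV[R]_n | Num.sqrt (\sum_(i < n) x ord0 i ^+ 2) <= 1].

Definition minkowski_sum (R : realType) (n : nat) (A B : set 'rV[R]_n) :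
    set 'rV[R]_n :=
  [set a + b | a in A & b in B].

Definition dilate (R : realType) (n : nat) (t : R) (A : set 'rV[R]_n) :
    set 'rV[R]_n :=
  [set t *: a | a in A].

(* A convex set, or the Minkowski sum of two Borel sets, need not be Borel, and
   a library measure is unspecified outside its sigma-algebra. Such sets are
   measured by the outer measure [mu_ext mu], which is [mu] on Borel sets and
   the completion of [mu] on the sets that are measurable for the completion. *)
Definition perimeter (R : realType) (n : nat)
    (mu : {measure set (borel_rV R n) -> \bar R}) (Q : set 'rV[R]_n) : \bar R :=
  limf_einf (fun e : R =>
    mu_ext mu (minkowski_sum Q (dilate e (@euclidean_ball R n)) `\` Q)
      * (e^-1)%:E)%E
    (0 : R)^'+.

Definition Gamma (R : realType) (n : nat)
    (mu : {measure set (borel_rV R n) -> \bar R}) : \bar R :=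
  ereal_sup [set perimeter mu Q | Q in
    [set Q : set 'rV[R]_n | convex_set (Q : set (convex_lmodType 'rV[R]_n))]].

(* Nonemptiness only matters for l = 0 and l = 1: the library has 0 `^ 0 = 1,
   so that an empty A with l = 0 would make the inequality fail. *)
Definition log_concave (R : realType) (n : nat)
    (mu : {measure set (borel_rV R n) -> \bar R}) : Prop :=
  forall (A B : set (borel_rV R n)) (l : R),
    measurable A -> measurable B -> A !=set0 -> B !=set0 -> 0 <= l <= 1 ->
    (poweR (mu A) l * poweR (mu B) (1 - l)
      <= mu_ext mu (minkowski_sum (dilate l A) (dilate (1 - l) B)))%E.

(* Integrability of the coordinates and of their squares is implied: an
   integral whose positive and negative parts are both infinite is -oo, and the
   variances are required to be 1. *)
Definition isotropic (R : realType) (n : nat)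
    (mu : probability (borel_rV R n) R) : Prop :=
  (forall i : 'I_n, ('E_mu[(fun x : 'rV[R]_n => x ord0 i)] = 0)%E) /\
  (forall i j : 'I_n,
     covariance mu (fun x : 'rV[R]_n => x ord0 i) (fun x : 'rV[R]_n => x ord0 j)
       = ((i == j)%:R)%:E).

(* Main.v *)
Require Import Defs.
From HB Require Import structures.
From mathcomp Require Import all_boot all_order all_algebra.
From mathcomp Require Import all_classical all_reals all_analysis.
From mathcomp Require Import measurable_realfun.
From mathcomp Require Import ring lra zify.
Set Implicit Arguments.
Unset Strict Implicit.
Unset Printing Implicit Defensive.
Import Order.TTheory GRing.Theory Num.Theory.
Import numFieldNormedType.Exports.
Local Open Scope classical_set_scope.
Local Open Scope ring_scope.

(** Replacing the Euclidean ball by the cube, the set [(Q + eB) \ Q] is covered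
    by at most [4n] "rims" [{x in C | x + v notin C}], with [C] closed and
    convex and [v = +-e e_i]; so it suffices that each rim has measure
    [O(n e)].  The translates of a rim [W] by the multiples of [v] are disjoint,
    and still are the sets [(1 - l) W + l z_k] with [l = 1/(2n)] and [z_k]
    suitable multiples of [v].  There are about [1/(n e)] values of [k] for
    which [z_k] stays close to the origin, so the bound follows once
    [(1 - l) W + l z] has at least a constant fraction of the mass of [W] for
    every [z] close to the origin.

    No density is available, so this contraction estimate is obtained by
    cutting [W] along a fine grid, with small gaps that keep the contracted
    pieces disjoint, and applying log-concavity to each piece and a small cube
    at [z]: the loss is the [l]-th power of the ratio between the masses of a
    small cube at [z] and of a cube of comparable size anywhere else.  That
    ratio is at least [c ^ n]: the centres of the cubes which are that heavy
    form a convex set, carrying nearly all the mass by a second grid argument,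
    whereas by isotropy every half-space close to the origin has mass bounded
    below; hence every point close to the origin is a limit of such centres. *)

(** Subadditivity is used on the left and additivity on the right, so only the [Y i] have to be
    disjoint. This is how estimates on single grid cells are summed. *)
Lemma measure_bigcup_le (d : measure_display) (T : measurableType d)
    (R : realType) (mu : {measure set T -> \bar R}) (J : countType)
    (X Y : J -> set T) (c : R) :
  0 <= c -> (forall i, measurable (X i)) -> (forall i, measurable (Y i)) ->
  trivIset setT Y -> (forall i, mu (X i) <= c%:E * mu (Y i))%E ->
  (mu (\bigcup_i X i) <= c%:E * mu (\bigcup_i Y i))%E.
Proof.
move=> c0 mX mY tY le_XY.
(* Reindexing by [nat]: numbers that are not codes get the empty set. *)
pose ext (Z : J -> set T) k := if pickle_inv k is Some i then Z i else set0.
have extE Z : \bigcup_i Z i = \bigcup_k ext Z k.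
  apply/seteqP; split=> [x [i _ Zx]|x [k _]].
    by exists (pickle i) => //; rewrite /ext pickleK_inv.
  by rewrite /ext; case: (pickle_inv k) => // i Zx; exists i.
have mext Z : (forall i, measurable (Z i)) -> forall k, measurable (ext Z k).
  by move=> mZ k; rewrite /ext; case: (pickle_inv k).
rewrite !extE.
apply: (@le_trans _ _ (\sum_(0 <= k <oo) mu (ext X k))%E).
  apply: measure_sigma_subadditive => //; first exact: mext.
  by apply: bigcup_measurable => k _; exact: mext.
rewrite [in leRHS]measure_bigcup //; first last.
- move=> j k _ _ [x []]; rewrite /ext.
  case ej: (pickle_inv j) => [i|//]; case ek: (pickle_inv k) => [i'|//] Yi Yi'.
  have ii' : i = i' by apply: (tY _ _ I I); exists x.
  have := @pickle_invK J j; have := @pickle_invK J k.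
  by rewrite ej ek ii' /= => -> ->.
- by move=> k _; exact: mext.
rewrite (_ : (\sum_(0 <= i <oo | i \in setT) _)%E
           = (\sum_(0 <= i <oo) mu (ext Y i))%E); last first.
  by apply: eq_eseriesl => i; rewrite in_setT.
rewrite -nneseriesZl //.
apply: lee_nneseries => // k _; rewrite /ext.
by case: (pickle_inv k) => [i|]; rewrite ?measure0 ?mule0.
Qed.

(** * Borel sets of row vectors, and log-concavity in terms of real-valued masses *)

Section Borel.
Context {R : realType} {n : nat}.
Implicit Types (A B S : set 'rV[R]_n) (x y : 'rV[R]_n).

Lemma open_borel A : open A -> measurable (A : set (borel_rV R n)).
Proof. by move=> oA; exact: sub_sigma_algebra. Qed.

Lemma closed_borel A : closed A -> measurable (A : set (borel_rV R n)).
Proof.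
move=> cA; rewrite -[A]setCK; apply: measurableC.
by apply: open_borel; exact: closed_openC.
Qed.

Lemma continuous_borel (f : 'rV[R]_n -> R) : continuous f ->
  measurable_fun setT (f : borel_rV R n -> R).
Proof.
move=> /continuousP cf.
apply: (measurability _ (RGenOpens.measurableE R)).
move=> _ [_ [a [b ->] <-]]; rewrite setTI.
by apply: open_borel; apply: cf; exact: interval_open.
Qed.

Context (mu : probability (borel_rV R n) R).
Local Notation m A := (fine (mu A)).

Lemma mass_ge0 A : 0 <= m A.
Proof. by rewrite fine_ge0. Qed.

Lemma mass_le A B : measurable (A : set (borel_rV R n)) ->
  measurable (B : set (borel_rV R n)) -> A `<=` B -> m A <= m B.
Proof.
by move=> mA mB AB; rewrite fine_le ?fin_num_measure// le_measure ?inE.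
Qed.

Lemma mass_le1 A : measurable (A : set (borel_rV R n)) -> m A <= 1.
Proof.
by move=> mA; rewrite -lee_fin fineK ?fin_num_measure// probability_le1.
Qed.

(** A Borel set [S] containing the Minkowski sum removes the outer measure. As [0 < l < 1], both
    exponents are positive and an empty [A] or [B] makes the left side vanish. *)
Lemma logconcave_mass A B S (l : R) : log_concave mu ->
  measurable (A : set (borel_rV R n)) -> measurable (B : set (borel_rV R n)) ->
  measurable (S : set (borel_rV R n)) -> 0 < l < 1 ->
  (forall a b, A a -> B b -> S (l *: a + (1 - l) *: b)) ->
  m A `^ l * m B `^ (1 - l) <= m S.
Proof.
move=> lc mA mB mS /andP[l0 l1] sub.
have [->|/set0P nA] := eqVneq A set0.
  by rewrite measure0 /= powR0 ?gt_eqF// mul0r mass_ge0.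
have [->|/set0P nB] := eqVneq B set0.
  by rewrite measure0 /= powR0 ?mulr0 ?mass_ge0// gt_eqF// subr_gt0.
rewrite -lee_fin EFinM -!poweR_EFin !fineK ?fin_num_measure//.
rewrite -(measurable_mu_extE mu mS).
have l01 : 0 <= l <= 1 by rewrite !ltW.
apply: (le_trans (lc _ _ _ mA mB nA nB l01)).
by apply: le_mu_ext => _ [_ [a Aa <-]] [_ [b Bb <-]] <-; exact: sub.
Qed.

Lemma logconcave_mid A B S : log_concave mu ->
  measurable (A : set (borel_rV R n)) -> measurable (B : set (borel_rV R n)) ->
  measurable (S : set (borel_rV R n)) ->
  (forall a b, A a -> B b -> S (2^-1 *: (a + b))) ->
  m A * m B <= m S ^+ 2.
Proof.
move=> lc mA mB mS sub.
have h : 0 < (2^-1 : R) < 1 by lra.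
have e : 1 - 2^-1 = 2^-1 :> R by lra.
have : m A `^ 2^-1 * m B `^ (1 - 2^-1) <= m S.
  apply: logconcave_mass => // a b Aa Bb.
  by rewrite e -scalerDr; exact: sub.
rewrite e !powR12_sqrt ?mass_ge0// => le_S.
by rewrite -ler_sqrt ?sqrtr_sqr ?ger0_norm ?sqrtrM ?mass_ge0 ?exprn_ge0 ?mass_ge0.
Qed.

(* The exponent [1 - l] on [A] only costs the factor [k `^ l]. *)
Lemma logconcave_contract A B S (l k : R) : log_concave mu ->
  measurable (A : set (borel_rV R n)) -> measurable (B : set (borel_rV R n)) ->
  measurable (S : set (borel_rV R n)) -> 0 < l < 1 -> 0 <= k ->
  (forall a b, A a -> B b -> S ((1 - l) *: a + l *: b)) ->
  k * m A <= m B -> k `^ l * m A <= m S.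
Proof.
move=> lc mA mB mS /andP[l0 l1] k0 sub kAB.
have l01 : 0 < 1 - l < 1 by lra.
have e : 1 - (1 - l) = l by lra.
apply: le_trans (@logconcave_mass A B S _ lc mA mB mS l01 _); rewrite e//.
apply: (@le_trans _ _ (m A `^ (1 - l) * (k * m A) `^ l)); last first.
  by rewrite ler_wpM2l ?powR_ge0// (ge0_ler_powR (ltW l0)) ?nnegrE ?mulr_ge0 ?mass_ge0.
rewrite powRM ?mass_ge0// mulrCA ler_wpM2l ?powR_ge0//.
have [->|mA0] := eqVneq (m A) 0; first by rewrite mulr_ge0 ?powR_ge0.
by rewrite -powRD ?mA0 ?implybT// subrK powRr1 ?mass_ge0.
Qed.

End Borel.

(** * Convex geometry *)

Definition cvx {R : realType} {n : nat} (A : set 'rV[R]_n) : Prop :=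
  forall x y (t : R), A x -> A y -> 0 <= t <= 1 -> A (t *: x + (1 - t) *: y).

Definition dot {R : realType} {n : nat} (u x : 'rV[R]_n) : R :=
  \sum_i u ord0 i * x ord0 i.

Section Geometry.
Context {R : realType} {n : nat}.
Implicit Types (A C Q : set 'rV[R]_n) (u v x y z : 'rV[R]_n).

Lemma norm_conv_lt (a b e t : R) : `|a| < e -> `|b| < e -> 0 <= t <= 1 ->
  `|t * a + (1 - t) * b| < e.
Proof.
move=> ae be /andP[t0 t1]; apply: (le_lt_trans (ler_normD _ _)).
have t1' : 0 <= 1 - t by lra.
rewrite !normrM (ger0_norm t0) (ger0_norm t1').
(* One of the two weights is at least 1/2, which keeps the inequality strict. *)
have [t2|t2] := leP t 2^-1; nra.
Qed.

Lemma row_ballP x (r : R) y : 0 < r ->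
  (ball x r y <-> forall i, `|x ord0 i - y ord0 i| < r).
Proof.
move=> r0; split=> [[_ xy] i|xy]; first exact: xy.
by split=> // i j; rewrite (ord1 i); exact: xy.
Qed.

Lemma dotDr u x y : dot u (x + y) = dot u x + dot u y.
Proof. by rewrite -big_split; apply: eq_bigr => i _; rewrite mxE mulrDr. Qed.

Lemma dotZr u (t : R) x : dot u (t *: x) = t * dot u x.
Proof. by rewrite mulr_sumr; apply: eq_bigr => i _; rewrite mxE mulrCA. Qed.

Lemma dotC u x : dot u x = dot x u.
Proof. by apply: eq_bigr => i _; rewrite mulrC. Qed.

Lemma dotZl u (t : R) x : dot (t *: u) x = t * dot u x.
Proof. by rewrite dotC dotZr dotC. Qed.

Lemma dotBr u x y : dot u (x - y) = dot u x - dot u y.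
Proof. by rewrite dotDr -scaleN1r dotZr mulN1r. Qed.

Lemma dotBl u v x : dot (u - v) x = dot u x - dot v x.
Proof. by rewrite dotC dotBr !(dotC x). Qed.

Lemma dot_ge0 u : 0 <= dot u u.
Proof. by apply: sumr_ge0 => i _; rewrite -expr2 sqr_ge0. Qed.

Lemma sqr_coord_le u i : u ord0 i ^+ 2 <= dot u u.
Proof.
rewrite /dot (bigD1 i)//= expr2 lerDl.
by apply: sumr_ge0 => j _; rewrite -expr2 sqr_ge0.
Qed.

Lemma dot_gt0 u : u != 0 -> 0 < dot u u.
Proof.
move=> u0; rewrite lt_def dot_ge0 andbT; apply: contra u0 => /eqP du.
apply/eqP/rowP => i; rewrite mxE; apply/eqP.
by rewrite -sqrf_eq0 eq_le sqr_ge0 -du sqr_coord_le.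
Qed.

Lemma continuous_sum (f : 'I_n -> 'rV[R]_n -> R) :
  (forall i, continuous (f i)) -> continuous (fun x => \sum_i f i x).
Proof.
move=> cf x; have h := @cvg_big R 'I_n +%R 0 xpredT (@add_continuous R) _ (nbhs x)
  (index_enum 'I_n) f (f^~ x).
by apply: h => i _; exact: cf.
Qed.

Lemma continuous_dot u : continuous (dot u).
Proof.
apply: continuous_sum => i x.
by apply: continuousM; [exact: cst_continuous|exact: coord_continuous].
Qed.

(** The normal [u] is the normalised difference between [z] and a nearest point [p] of [C]. *)
Lemma separation C z : closed C -> cvx C -> C !=set0 -> ~ C z ->
  exists2 u, dot u u = 1 & forall x, C x -> dot u x <= dot u z.
Proof.
move=> clC cvC [x1 Cx1] nCz.
pose f x := dot (x - z) (x - z).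
have cf : continuous f.
  apply: continuous_sum => i x.
  have cx : {for x, continuous (fun y => (y - z) ord0 i)}.
    rewrite (_ : (fun y => _) = (fun y : 'rV[R]_n => y ord0 i - z ord0 i)).
      by apply: continuousB; [exact: coord_continuous|exact: cst_continuous].
    by apply/funext => y; rewrite !mxE.
  by apply: continuousM; exact: cx.
(* A compact cube around [z] containing every point no farther from [z] than [x1]: a number whose
   square is at most [f x1] is at most [1 + f x1]. *)
pose K := [set x : 'rV[R]_n |
  forall i, `[z ord0 i - (1 + f x1), z ord0 i + (1 + f x1)]%classic (x ord0 i)].
have KE x : f x <= f x1 -> K x.
  move=> fx i /=; rewrite in_itv /=.
  have : (x ord0 i - z ord0 i) ^+ 2 <= f x1.
    by apply: le_trans fx; have := sqr_coord_le (x - z) i; rewrite !mxE.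
  have : 0 <= f x1 by exact: dot_ge0.
  by move=> f0 h; apply/andP; split; nra.
have cK : compact (K `&` C).
  apply: compact_closedI => //.
  exact: (rV_compact (fun i => @segment_compact R (z ord0 i - (1 + f x1)) _)).
have [p] := EVT_min_rV (ex_intro _ x1 (conj (KE _ (lexx _)) Cx1)) cK
  (continuous_subspaceT cf).
rewrite inE => -[Kp Cp] minp.
have minC x : C x -> f p <= f x.
  move=> Cx; have [le_x|/ltW lt_x] := leP (f x) (f x1).
    by apply: minp; rewrite inE; split=> //; exact: KE.
  by apply: le_trans lt_x; apply: minp; rewrite inE; split=> //; exact: KE.
have [w wE] : exists w, w = z - p by exists (z - p).
have w0 : w != 0.
  by apply: contra_notN nCz; rewrite wE => /eqP/subr0_eq ->.
have ww := dot_gt0 w0.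
have obtuse x : C x -> dot w x <= dot w p.
  move=> Cx; rewrite -subr_le0 -dotBr leNgt; apply/negP => a0.
  have [y yE] : exists y, y = x - p by exists (x - p).
  rewrite -yE in a0; set a := dot w y in a0; set b := dot y y.
  have b0 : 0 <= b by exact: dot_ge0.
  (* Moving from [p] towards [x] by the fraction [t] changes the squared distance to [z] by
     [t * (t * b - 2 * a)]. This choice gives [t * b < a], so the change is negative, against the
     minimality of [p]. *)
  pose t := a / (a + b).
  have ab : 0 < a + b by lra.
  have tE : t * (a + b) = a by rewrite divfK// gt_eqF.
  have t01 : 0 <= t <= 1.
    by rewrite /t divr_ge0 ?(ltW a0) ?(ltW ab)//= ler_pdivrMr ?mul1r// lerDl.
  have /minC := cvC _ _ _ Cx Cp t01.
  have -> : t *: x + (1 - t) *: p = t *: y + p.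
    by rewrite yE scalerBl scale1r scalerBr addrCA addrC.
  have -> : f p = dot w w.
    by rewrite /f -(opprB z p) -wE -scaleN1r dotZl dotZr !mulN1r opprK.
  rewrite /f (_ : _ - z = t *: y - w); last by rewrite wE opprB addrA.
  rewrite !(dotBl, dotBr, dotZl, dotZr) (dotC y w).
  rewrite -/a -/b; nra.
exists ((Num.sqrt (dot w w))^-1 *: w).
  rewrite dotZl dotZr mulrA -expr2 exprVn sqr_sqrtr ?dot_ge0//.
  by rewrite mulVf// gt_eqF.
move=> x Cx; rewrite !dotZl ler_wpM2l ?invr_ge0 ?sqrtr_ge0//.
apply: le_trans (obtuse _ Cx) _.
by rewrite -subr_ge0 -dotBr -wE dot_ge0.
Qed.

Lemma cvx_closure A : cvx A -> cvx (closure A).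
Proof.
move=> cvA x y t clx cly t01 B /nbhs_ballP[e /= e0 eB].
have [x' [Ax' xx']] := clx _ (nbhsx_ballx x e e0).
have [y' [Ay' yy']] := cly _ (nbhsx_ballx y e e0).
exists (t *: x' + (1 - t) *: y'); split; first exact: cvA.
apply/eB/(row_ballP _ _ e0) => i; rewrite !mxE.
move/(row_ballP _ _ e0) : xx' => /(_ i); move/(row_ballP _ _ e0) : yy' => /(_ i).
move=> yy' xx'.
rewrite (_ : _ - _ = t * (x ord0 i - x' ord0 i)
                   + (1 - t) * (y ord0 i - y' ord0 i)); last by ring.
exact: norm_conv_lt.
Qed.

Lemma cvx_segment C x v (a b : R) : cvx C -> 0 <= a -> 0 <= b ->
  C (x + a *: v) -> C (x - b *: v) -> C x.
Proof.
move=> cvC a0 b0 Ca Cb; have [ab0|ab0] := eqVneq (a + b) 0.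
  have a00 : a = 0 by lra.
  by move: Ca; rewrite a00 scale0r addr0.
have ab : 0 < a + b by rewrite lt_def ab0 addr_ge0.
have t01 : 0 <= b / (a + b) <= 1.
  by rewrite divr_ge0 ?(ltW ab)//= ler_pdivrMr ?mul1r// lerDr.
have := cvC _ _ _ Ca Cb t01; congr C; apply/rowP => i; rewrite !mxE.
by field.
Qed.

(* Points of [Q] in all open orthants at [x] can be combined pairwise, one
   coordinate at a time, until all coordinates agree with those of [x]. *)
Lemma cvx_orthant Q x : cvx Q ->
  (forall s : {ffun 'I_n -> bool},
     exists2 q, Q q & forall i, 0 < (-1) ^+ s i * (q ord0 i - x ord0 i)) ->
  Q x.
Proof.
move=> cvQ hQ.
have step k : (k <= n)%N -> forall s : {ffun 'I_n -> bool}, exists2 q, Q q &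
    forall i : 'I_n, if (i < k)%N then q ord0 i = x ord0 i
      else 0 < (-1) ^+ s i * (q ord0 i - x ord0 i).
  elim: k => [_ s|k IH kn s]; first by have [q] := hQ s; exists q.
  pose sk b := [ffun i => if i == Ordinal kn then b else s i].
  have [q Qq hq] := IH (ltnW kn) (sk false).
  have [q' Qq' hq'] := IH (ltnW kn) (sk true).
  set a := q ord0 (Ordinal kn) - x ord0 (Ordinal kn).
  set b := x ord0 (Ordinal kn) - q' ord0 (Ordinal kn).
  have a0 : 0 < a.
    by have := hq (Ordinal kn); rewrite ltnn ffunE eqxx expr0 mul1r.
  have b0 : 0 < b.
    by have := hq' (Ordinal kn); rewrite ltnn ffunE eqxx expr1 mulN1r opprB.
  have ab : 0 < a + b by rewrite addr_gt0.
  have t01 : 0 < b / (a + b) < 1.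
    by rewrite divr_gt0//= ltr_pdivrMr// mul1r ltrDr.
  exists ((b / (a + b)) *: q + (1 - b / (a + b)) *: q').
    by apply: cvQ => //; case/andP: t01 => /ltW -> /ltW.
  move=> i; rewrite ltnS leq_eqVlt; have [ik|ik] /= := eqVneq (i : nat) k.
    have -> : i = Ordinal kn by exact: val_inj.
    rewrite !mxE.
    have -> : q ord0 (Ordinal kn) = x ord0 (Ordinal kn) + a by rewrite /a; ring.
    have -> : q' ord0 (Ordinal kn) = x ord0 (Ordinal kn) - b by rewrite /b; ring.
    by field; rewrite gt_eqF.
  have ik' : (i == Ordinal kn) = false.
    by apply/negP => /eqP ik'; move: ik; rewrite ik' /= eqxx.
  have := hq i; have := hq' i; rewrite !ffunE ik' !mxE.
  set t := b / (a + b) in t01 *; case: ifP => _; first by move=> -> ->; ring.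
  by case: (s i); rewrite ?expr0 ?expr1 ?mul1r ?mulN1r; nra.
have [q Qq hq] := step n (leqnn n) [ffun=> false].
suff -> : x = q by [].
by apply/rowP => i; have := hq i; rewrite ltn_ord => ->.
Qed.

(** The orthant condition consists of finitely many strict inequalities once the points [q] are
    fixed, so it persists near [x], and [cvx_orthant] applies at each nearby point. *)
Lemma cvx_orthant_interior Q x : cvx Q ->
  (forall s : {ffun 'I_n -> bool},
     exists2 q, Q q & forall i, 0 < (-1) ^+ s i * (q ord0 i - x ord0 i)) ->
  (Q°) x.
Proof.
move=> cvQ hQ.
have : nbhs x (fun y : 'rV[R]_n => forall s : {ffun 'I_n -> bool},
    exists2 q, Q q & forall i, 0 < (-1) ^+ s i * (q ord0 i - y ord0 i)).
  apply: (@filter_forall _ _ (fun (s : {ffun 'I_n -> bool}) (y : 'rV[R]_n) =>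
    exists2 q, Q q & forall i, 0 < (-1) ^+ s i * (q ord0 i - y ord0 i)) (nbhs x)).
  move=> s; have [q Qq hq] := hQ s.
  have : nbhs x (fun y : 'rV[R]_n =>
      forall i, 0 < (-1) ^+ s i * (q ord0 i - y ord0 i)).
    apply: (@filter_forall _ _ (fun i (y : 'rV[R]_n) =>
      0 < (-1) ^+ s i * (q ord0 i - y ord0 i)) (nbhs x)) => i.
    have c : {for x, continuous
        (fun y : 'rV[R]_n => (-1) ^+ s i * (q ord0 i - y ord0 i))}.
      apply: continuousM; first exact: cst_continuous.
      by apply: continuousB; [exact: cst_continuous|exact: coord_continuous].
    exact: (@cvgr_gt R _ (nbhs x) _ _ _ c _ (hq i)).
  by apply: filterS => y hy; exists q.
by apply: filterS => y hy; exact: cvx_orthant.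
Qed.

(** A ball around [x] inside the closure contains, in each orthant, a point [y] with all offsets
    equal to [e / 2]; a point of [Q] closer to [y] than that has the same signs. *)
Lemma interior_closure_cvx Q : cvx Q -> (closure Q)° `<=` Q.
Proof.
move=> cvQ x /nbhs_ballP[e /= e0 ex].
apply: cvx_orthant => // s.
pose y := \row_i (x ord0 i + (-1) ^+ s i * (e / 2)).
have sE i : `|(-1) ^+ s i * (e / 2)| = e / 2.
  by rewrite normrMsign ger0_norm// divr_ge0// ltW.
have : closure Q y.
  apply/ex/(row_ballP _ _ e0) => i; rewrite mxE opprD addNKr normrN sE; lra.
have e20 : 0 < e / 2 by lra.
move=> /(_ _ (nbhsx_ballx y _ e20))[q [Qq yq]].
exists q => // i; move/(row_ballP _ _ e20) : yq => /(_ i); rewrite mxE ltr_norml.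
by case: (s i); rewrite ?expr0 ?expr1 ?mul1r ?mulN1r => /andP[]; lra.
Qed.

Local Notation e_ i := (delta_mx ord0 i : 'rV[R]_n).

Definition rim C v : set 'rV[R]_n := [set x | C x /\ ~ C (x + v)].

(** Outside all rims, every neighbour [x +- e e_i] lies in [C]. Averaging successively with one
    neighbour per coordinate, selected by the sign pattern, gives points of [C] in all open orthants
    at [x]. *)
Lemma cvx_sub_interior C (e : R) : cvx C -> 0 < e ->
  C `\` C° `<=` \bigcup_(i : 'I_n) (rim C (e *: e_ i) `|` rim C (- e *: e_ i)).
Proof.
move=> cvC e0 x [Cx nCx]; apply: contrapT => nrim; apply: nCx.
have Cs (b : bool) i : C (x + ((-1) ^+ b * e) *: e_ i).
  apply: contrapT => nC; apply: nrim; exists i => //; case: b nC.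
    by rewrite expr1 mulN1r => nC; right; split.
  by rewrite expr0 mul1r => nC; left; split.
apply: cvx_orthant_interior => // s.
have step k : (k <= n)%N -> exists2 q, C q & forall i : 'I_n,
    if (k <= i)%N then q ord0 i = x ord0 i
    else 0 < (-1) ^+ s i * (q ord0 i - x ord0 i).
  elim: k => [_|k IH kn]; first by exists x.
  have [q Cq hq] := IH (ltnW kn).
  exists (2^-1 *: q + (1 - 2^-1) *:
      (x + ((-1) ^+ s (Ordinal kn) * e) *: e_ (Ordinal kn))).
    by apply: cvC => //; lra.
  move=> i; have := hq i; rewrite !mxE eqxx /=.
  have [ik|ik|ik] := ltngtP k i.
  - have -> : (i == Ordinal kn) = false.
      by apply/negP => /eqP ik'; move: ik; rewrite ik' /= ltnn.
    by move=> ->; rewrite mulr0 addr0; field.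
  - have -> : (i == Ordinal kn) = false.
      by apply/negP => /eqP ik'; move: ik; rewrite ik' /= ltnn.
    rewrite mulr0 addr0.
    by case: (s i); rewrite ?expr0 ?expr1 ?mul1r ?mulN1r; lra.
  have -> : i = Ordinal kn by exact: val_inj.
  rewrite eqxx => ->.
  by case: (s _); rewrite ?expr0 ?expr1 ?mul1r ?mulN1r /=; lra.
have [q Cq hq] := step n (leqnn n).
by exists q => // i; have := hq i; rewrite leqNgt ltn_ord.
Qed.

(** The Minkowski sum of [C] with the segment from [-e e_i] to [e e_i]. Doing this along every
    coordinate adds a cube to [C], and each stage only creates two rims. *)
Definition thicken C (e : R) (i : 'I_n) : set 'rV[R]_n :=
  [set x | exists2 s, `|s| <= e & C (x + s *: e_ i)].

(** By compactness of the parameter segment, the complement is open. *)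
Lemma closed_thicken C e i : closed C -> closed (thicken C e i).
Proof.
move=> clC; rewrite -[thicken _ _ _]setCK; apply: open_closedC.
rewrite openE => x nTx.
have /compact_near_coveringP cov := @segment_compact R (- e) e.
have : nbhs x (fun y : 'rV[R]_n =>
    `[- e, e]%classic `<=` (fun s => ~ C (y + s *: e_ i))).
  apply: (cov _ (nbhs x) (fun y s => ~ C (y + s *: e_ i))) => s.
  rewrite /= in_itv /= => se.
  have nC : ~ C (x + s *: e_ i).
    by move=> Cx; apply: nTx; exists s => //; rewrite ler_norml.
  have cadd : (fun p : R * 'rV[R]_n => p.2 + p.1 *: e_ i) @ (s, x) -->
      x + s *: e_ i.
    apply: cvgD; first exact: cvg_snd.
    by apply: cvgZr_tmp; exact: cvg_fst.
  have := cadd (~` C); apply.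
  by apply: open_nbhs_nbhs; split=> //; exact: closed_openC.
apply: filterS => y hy [s se]; apply: hy.
by rewrite /= in_itv /= -ler_norml.
Qed.

Lemma cvx_thicken C e i : cvx C -> cvx (thicken C e i).
Proof.
move=> cvC x y t [s se Cx] [s' s'e Cy] t01.
exists (t * s + (1 - t) * s').
  move: se s'e t01; rewrite !ler_norml => /andP[? ?] /andP[? ?] /andP[? ?].
  by apply/andP; split; nra.
have := cvC _ _ _ Cx Cy t01; congr C.
by apply/rowP => j; rewrite !mxE; ring.
Qed.

(** If both translates of [x] stay in the thickened set, then [C] meets the line through [x] at the
    offsets [e + s >= 0] and [s' - e <= 0], hence contains [x]. *)
Lemma thicken_setD C e i : cvx C -> 0 <= e ->
  thicken C e i `\` C `<=`
    rim (thicken C e i) (e *: e_ i) `|` rim (thicken C e i) (- e *: e_ i).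
Proof.
move=> cvC e0 x [Tx nCx]; apply: contrapT => nrim; apply: nCx.
have Tp : thicken C e i (x + e *: e_ i).
  by apply: contrapT => nT; apply: nrim; left; split.
have Tm : thicken C e i (x + - e *: e_ i).
  by apply: contrapT => nT; apply: nrim; right; split.
move: Tp Tm => -[s se Cs] [s' s'e Cs'].
move: se s'e; rewrite !ler_norml => /andP[? ?] /andP[? ?].
apply: (@cvx_segment C x (e_ i) (e + s) (e - s')) => //; [lra|lra| |].
  by move: Cs; rewrite -addrA -scalerDl.
by move: Cs'; rewrite -addrA -scalerDl -scaleNr opprB addrC addrC [- e + s']addrC.
Qed.

Definition thicken_along C (e : R) (l : seq 'I_n) : set 'rV[R]_n :=
  foldr (fun i D => thicken D e i) C l.

Lemma closed_thicken_along C e l : closed C -> closed (thicken_along C e l).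
Proof. by move=> clC; elim: l => //= i l; exact: closed_thicken. Qed.

Lemma cvx_thicken_along C e l : cvx C -> cvx (thicken_along C e l).
Proof. by move=> cvC; elim: l => //= i l; exact: cvx_thicken. Qed.

Lemma mem_thicken_along C e l x y : 0 <= e -> C y ->
  (forall i, `|y ord0 i - x ord0 i| <= e) ->
  (forall i, i \notin l -> x ord0 i = y ord0 i) -> thicken_along C e l x.
Proof.
move=> e0 Cy; elim: l x => [|i l IH] x xy xl /=.
  by suff -> : x = y by []; apply/rowP => i; exact: xl.
exists (y ord0 i - x ord0 i) => //; apply: IH => j.
  rewrite !mxE eqxx /=; have [->|ji] := eqVneq j i; last by rewrite mulr0 addr0.
  by rewrite mulr1 addrC subrK subrr normr0.
move=> jl; rewrite !mxE eqxx /=; have [->|ji] := eqVneq j i.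
  by rewrite mulr1 addrC subrK.
by rewrite mulr0 addr0; apply: xl; rewrite inE negb_or ji.
Qed.

(** Collar points in the closure of [Q] are boundary points by [interior_closure_cvx]. The others
    are caught by the thickening, because the Euclidean ball lies in the cube. *)
Lemma minkowski_setD_sub Q (e : R) : cvx Q -> 0 < e ->
  minkowski_sum Q (dilate e (@euclidean_ball R n)) `\` Q `<=`
    (closure Q `\` (closure Q)°) `|`
    (thicken_along (closure Q) e (enum 'I_n) `\` closure Q).
Proof.
move=> cvQ e0 x [[q Qq [_ [b /= b1 <-]] <-] nQ].
have [clx|nclx] := pselect (closure Q (q + e *: b)); [left|right]; split=> //.
  by move=> /(interior_closure_cvx cvQ).
apply: (@mem_thicken_along _ _ _ _ q) => //; [exact: ltW|exact: subset_closure| |].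
  move=> i; rewrite !mxE opprD addNKr normrN normrM gtr0_norm//.
  rewrite ler_piMr ?(ltW e0)// -sqrtr_sqr; apply: le_trans b1.
  rewrite ler_sqrt; last by apply: sumr_ge0 => j _; exact: sqr_ge0.
  by rewrite (bigD1 i)//= lerDl; apply: sumr_ge0 => j _; exact: sqr_ge0.
by move=> i; rewrite mem_enum.
Qed.

End Geometry.

(** * Tails of centred log-concave variables of unit variance *)

Section Tails.
Context {d : measure_display} {T : measurableType d} {R : realType}.
Context (P : probability T R).
Implicit Types (Y : T -> R) (a c : R).

Definition upper_tail Y a : R := fine (P [set x | a <= Y x]).

Definition excess Y a (x : T) : R := Num.max (Y x - a) 0 ^+ 2.

Lemma measurable_ge_set Y a : measurable_fun setT Y ->
  measurable [set x | a <= Y x].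
Proof.
move=> mY; have := mY measurableT `[a, +oo[%classic (measurable_itv _).
rewrite setTI; congr measurable.
by apply/seteqP; split=> x /=; rewrite in_itv /= andbT.
Qed.

Lemma upper_tailE Y a : measurable_fun setT Y ->
  P [set x | a <= Y x] = (upper_tail Y a)%:E.
Proof.
by move=> mY; rewrite fineK// fin_num_measure//; exact: measurable_ge_set.
Qed.

Lemma upper_tail_anti Y a c : measurable_fun setT Y -> a <= c ->
  upper_tail Y c <= upper_tail Y a.
Proof.
move=> mY ac; rewrite -lee_fin -!upper_tailE//.
apply: le_measure; rewrite ?inE; [exact: measurable_ge_set..|].
by move=> x /=; exact: le_trans.
Qed.

Lemma upper_tail_ge0 Y a : 0 <= upper_tail Y a.
Proof. by rewrite fine_ge0. Qed.

Lemma measurable_excess Y a : measurable_fun setT Y ->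
  measurable_fun setT (excess Y a).
Proof.
move=> mY; apply: measurable_funX; apply: measurable_maxr => //.
exact: measurable_funB.
Qed.

Lemma excess_ge0 Y a x : 0 <= excess Y a x.
Proof. exact: sqr_ge0. Qed.

Definition midpoint_log_concave (q : R -> R) :=
  forall s t, q s * q t <= q (2^-1 * (s + t)) ^+ 2.

(* Log-concavity propagates the initial drop of the tail from [1/2] to [1/16],
   so that the tail decays at least like [8 ^- k] along the progression
   [a + k h]. *)
Lemma upper_tail_geometric Y (a h th : R) (k : nat) : measurable_fun setT Y ->
  0 < h -> midpoint_log_concave (upper_tail Y) ->
  2^-1 <= upper_tail Y (a - h) -> upper_tail Y a <= th -> th <= 16^-1 ->
  upper_tail Y (a + k%:R * h) <= th / 8 ^+ k.
Proof.
move=> mY h0 lc q1 q0 th16.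
have q_ge0 := upper_tail_ge0 Y.
(* The induction also carries the ratio 8 between consecutive tails; midpoint log-concavity passes
   it on. It starts from [8 / 16 = 1 / 2]. *)
suff [] : 8 * upper_tail Y (a + k%:R * h) <= upper_tail Y (a + k%:R * h - h) /\
    upper_tail Y (a + k%:R * h) <= th / 8 ^+ k by [].
elim: k => [|k [IH1 IH2]].
  by rewrite mul0r addr0 expr0 divr1; split=> //; lra.
have e : a + k.+1%:R * h = a + k%:R * h + h by rewrite -natr1; ring.
rewrite e addrK; set b := a + k%:R * h in IH1 IH2 *.
have := lc (b - h) (b + h).
have -> : 2^-1 * (b - h + (b + h)) = b by field.
have bh : upper_tail Y (b + h) <= upper_tail Y b by apply: upper_tail_anti => //; lra.
move: (q_ge0 (b - h)) (q_ge0 b) (q_ge0 (b + h)) IH1 IH2 bh.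
move: (upper_tail Y (b - h)) (upper_tail Y b) (upper_tail Y (b + h)).
move=> u v w u0 v0 w0 uv vth wv uw.
suff wv8 : 8 * w <= v.
  split=> //; rewrite exprS invfM mulrCA ler_pdivlMl//.
  exact: le_trans wv8 vth.
have [u00|u_gt0] := leP u 0; first by nra.
by rewrite -(ler_pM2l u_gt0); nra.
Qed.

(** On the layer between [a + k h] and [a + (k + 1) h] the excess is at most [h ^ 2 * (k + 1) ^ 2],
    hence at most [h ^ 2 * 4 ^ k]. Against the tail bound [th / 8 ^ k] this leaves a geometric
    series of ratio 1/2. *)
Lemma integral_excess_le Y (a h th : R) : measurable_fun setT Y ->
  0 < h -> midpoint_log_concave (upper_tail Y) ->
  2^-1 <= upper_tail Y (a - h) -> upper_tail Y a <= th -> 0 <= th <= 16^-1 ->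
  (\int[P]_x (excess Y a x)%:E <= (2 * h ^+ 2 * th)%:E)%E.
Proof.
move=> mY h0 lc q1 q0 /andP[th0 th16].
pose A k := [set x | a + k%:R * h <= Y x].
have mA k : measurable (A k) by exact: measurable_ge_set.
pose f k (x : T) : \bar R := ((h ^+ 2 * 4 ^+ k) * \1_(A k) x)%:E.
have f0 k x : (0 <= f k x)%E.
  by rewrite lee_fin !mulr_ge0 ?exprn_ge0// ltW.
have mf k : measurable_fun setT (f k).
  by apply/measurable_EFinP; apply: measurable_funM => //; exact: measurable_indic.
have excess_le x : ((excess Y a x)%:E <= \sum_(0 <= k <oo) f k x)%E.
  have [Ya|Ya] := leP (Y x - a) 0.
    by rewrite /excess max_r// expr0n /=; exact: nneseries_ge0.
  pose k := Num.trunc ((Y x - a) / h).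
  have Yh : 0 <= (Y x - a) / h by rewrite divr_ge0 ?(ltW Ya) ?(ltW h0).
  have /andP[k1 k2] := truncn_itv Yh.
  apply: (@le_trans _ _ (f k x)).
    rewrite lee_fin indicE mem_set /=; last first.
      by rewrite /A /=; move: k1; rewrite ler_pdivlMr// -/k; lra.
    rewrite mulr1 /excess max_l ?(ltW Ya)//.
    move: k2; rewrite ltr_pdivrMr// -/k => k2.
    rewrite (_ : 4 = 2 ^+ 2); last by ring.
    rewrite -exprM mulnC exprM -exprMn ler_pXn2r ?nnegrE ?(ltW Ya)//; last first.
      by rewrite mulr_ge0 ?exprn_ge0// ltW.
    rewrite (le_trans (ltW k2))// mulrC ler_pM2l// -natrX ler_nat.
    exact: ltn_expl.
  apply: le_trans (nneseries_lim_ge k.+1 (fun j _ _ => f0 j x)).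
  by rewrite big_nat_recr//= leeDr// sume_ge0.
apply: (@le_trans _ _ (\int[P]_x (\sum_(0 <= k <oo) f k x))%E).
  apply: ge0_le_integral => //.
  - by move=> x _; rewrite lee_fin excess_ge0.
  - by apply/measurable_EFinP; exact: measurable_excess.
  - by apply: ge0_emeasurable_sum.
rewrite integral_nneseries//.
apply: (@le_trans _ _ (\sum_(0 <= k <oo)
    ((2 * h ^+ 2 * th) / (2 ^ (k + 1))%:R)%:E)%E); last first.
  by rewrite (cvg_lim _ (@cvg_geometric_eseries_half R _ 0))// expr0 divr1.
apply: lee_nneseries => [k _ _|k _]; first exact: integral_ge0.
rewrite /f; under eq_integral do rewrite EFinM.
rewrite ge0_integralZl_EFin//; last 2 first.
- by apply/measurable_EFinP; exact: measurable_indic.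
- by rewrite mulr_ge0 ?exprn_ge0// ltW.
rewrite integral_indic// setIT [X in (_ * X)%E](upper_tailE (a + k%:R * h) mY).
rewrite -EFinM lee_fin.
have := upper_tail_geometric k mY h0 lc q1 q0 th16.
move/(ler_wpM2l (_ : 0 <= h ^+ 2 * 4 ^+ k)) => le_k.
apply: le_trans (le_k _) _; first by rewrite mulr_ge0 ?exprn_ge0// ltW.
rewrite natrX addn1 (exprS _ k) (_ : 8 = 2 * 4 :> R); last by ring.
rewrite exprMn le_eqVlt; apply/orP; left; apply/eqP; field.
by rewrite !expf_neq0// pnatr_eq0.
Qed.

Lemma ge0_integral_affine (f : T -> R) c (k : R) : measurable_fun setT f ->
  (forall x, 0 <= f x) -> 0 <= c -> 0 <= k ->
  (\int[P]_x (c + k * f x)%:E = c%:E + k%:E * \int[P]_x (f x)%:E)%E.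
Proof.
move=> mf f0 c0 k0; under eq_integral do rewrite EFinD EFinM.
rewrite ge0_integralD//; last 2 first.
- by move=> x _; rewrite -EFinM lee_fin mulr_ge0.
- by apply: measurable_funeM; exact/measurable_EFinP.
rewrite integral_cst// ge0_integralZl_EFin//.
- by have := probability_setT P => /= ->; rewrite mule1.
- by move=> x _; rewrite lee_fin.
- exact/measurable_EFinP.
Qed.

Lemma measure_le_integral (A : set T) (g : T -> \bar R) : measurable A ->
  measurable_fun setT g -> (forall x, 0 <= g x)%E ->
  (forall x, A x -> 1 <= g x)%E -> (P A <= \int[P]_x g x)%E.
Proof.
move=> mA mg g0 Ag; rewrite -[A in leLHS]setIT -integral_indic//.
apply: ge0_le_integral => //.
- by apply/measurable_EFinP; exact: measurable_indic.
- move=> x _; rewrite indicE.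
  by case: (boolP (x \in A)) => [/set_mem/Ag|_] //=; exact: g0.
Qed.

(* If the upper tail at [1/100] were tiny, log-concavity would make [Y^+]
   small in mean; as [Y] is centred, so would be [Y^-]; then the lower tail at
   [-1/2] is small, and log-concavity again forces the variance below [1]. *)
Lemma upper_tail_gt Y : measurable_fun setT Y ->
  (\int[P]_x (Y x)%:E = 0)%E -> (\int[P]_x (Y x ^+ 2)%:E = 1)%E ->
  midpoint_log_concave (upper_tail Y) ->
  midpoint_log_concave (upper_tail (fun x => - Y x)) ->
  (100 * 1000)^-1 < upper_tail Y 100^-1.
Proof.
move=> mY EY EY2 lcY lcN; rewrite ltNge; apply/negP => small.
have mN : measurable_fun setT (fun x => - Y x) by exact: measurableT_comp.
have mY2 : measurable_fun setT (fun x => Y x ^+ 2) by exact: measurable_funX.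
have PC A : measurable A -> fine (P (~` A)) = 1 - fine (P A).
  by move=> mA; rewrite probability_setC// fineB// fin_num_measure.
(* The step 201/100 leads from 1/100 back to -2, where Chebyshev's inequality leaves a tail of at
   least 3/4. *)
have tail_m2 : 2^-1 <= upper_tail Y (100^-1 - 201 / 100).
  rewrite (_ : _ - _ = - 2); last by lra.
  have mge := measurable_ge_set (- 2) mY.
  have : (P (~` [set x | (- 2 <= Y x)%R]) <=
      \int[P]_x (0 + 4^-1 * Y x ^+ 2)%:E)%E.
    apply: measure_le_integral; first exact: measurableC.
    - by apply/measurable_EFinP; apply: measurable_funD => //; exact: measurable_funM.
    - by move=> x; rewrite lee_fin add0r mulr_ge0 ?sqr_ge0.
    - by move=> x /= /negP; rewrite -ltNge lee_fin => ?; nra.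
  rewrite ge0_integral_affine//; last by move=> x; exact: sqr_ge0.
  rewrite EY2 add0e mule1 -[leLHS]fineK ?fin_num_measure//; last exact: measurableC.
  by rewrite lee_fin PC// /upper_tail; lra.
have A_le := integral_excess_le mY (_ : 0 < 201 / 100) lcY tail_m2 small.
have {}A_le : (\int[P]_x (excess Y 100^-1 x)%:E
    <= (2 * (201 / 100) ^+ 2 * (100 * 1000)^-1)%:E)%E by apply: A_le; lra.
have mA := measurable_excess 100^-1 mY.
(* With [w = Y - 1/100], the domination by [1/50 + 25 w ^ 2] is [25 (w - 1/50) ^ 2 >= 0]. *)
have pos_le : (\int[P]_x ((EFin \o Y)^\+%E x) <= (3 / 100)%:E)%E.
  apply: (@le_trans _ _ (\int[P]_x (50^-1 + 25 * excess Y 100^-1 x)%:E)%E).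
    apply: ge0_le_integral => //.
    - by apply: measurable_funepos; exact/measurable_EFinP.
    - by apply/measurable_EFinP; apply: measurable_funD => //; exact: measurable_funM.
    - move=> x _; rewrite funeposE /= -EFin_max lee_fin ge_max /excess.
      have := sqr_ge0 (Y x - 100^-1 - 50^-1).
      by have [?|?] := leP (Y x - 100^-1) 0 => ?; apply/andP; split; nra.
  rewrite ge0_integral_affine//; last by move=> x; exact: excess_ge0.
  apply: (@le_trans _ _ (50^-1%:E + 25%:E *
      (2 * (201 / 100) ^+ 2 * (100 * 1000)^-1)%:E)%E).
    by rewrite leeD2l// lee_wpmul2l.
  by rewrite -EFinM -EFinD lee_fin; lra.
have neg_le : (\int[P]_x ((EFin \o Y)^\-%E x) <= (3 / 100)%:E)%E.
  move: EY; rewrite integralE.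
  have : (0 <= \int[P]_x ((EFin \o Y)^\+%E x))%E by apply: integral_ge0.
  have : (0 <= \int[P]_x ((EFin \o Y)^\-%E x))%E by apply: integral_ge0.
  move: pos_le; case: (\int[P]_x _)%E => [u| |]; case: (\int[P]_x _)%E => [v| |] //=.
  by rewrite !lee_fin => ? ? ? [?]; lra.
(* Markov's inequality gives 6/100, just below the 1/16 required by [integral_excess_le]. *)
have tail_half : upper_tail (fun x => - Y x) 2^-1 <= 16^-1.
  have mge := measurable_ge_set 2^-1 mN.
  have : (P [set x | (2^-1 <= - Y x)%R] <=
      \int[P]_x (2%:E * (EFin \o Y)^\-%E x))%E.
    apply: measure_le_integral => //.
    - apply: measurable_funeM; apply: measurable_funeneg; exact/measurable_EFinP.
    - by move=> x; rewrite mule_ge0 ?funeneg_ge0.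
    - move=> x /= h; rewrite funenegE /= max_l -?EFinM lee_fin; lra.
  rewrite ge0_integralZl_EFin//; last first.
    by apply: measurable_funeneg; exact/measurable_EFinP.
  rewrite upper_tailE// => h; rewrite -lee_fin; apply: (le_trans h).
  apply: (@le_trans _ _ (2%:E * (3 / 100)%:E)%E); first exact: lee_wpmul2l.
  by rewrite -EFinM lee_fin; lra.
(* The step 51/100 leads from 1/2 back to -1/100, where the tail of [- Y] is nearly 1 since [Y]
   rarely reaches 1/100. *)
have tail_m : 2^-1 <= upper_tail (fun x => - Y x) (2^-1 - 51 / 100).
  rewrite (_ : _ - _ = - 100^-1); last by lra.
  have mge := measurable_ge_set 100^-1 mY.
  have : fine (P (~` [set x | 100^-1 <= Y x])) <= upper_tail (fun x => - Y x) (- 100^-1).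
    rewrite -lee_fin -upper_tailE// fineK ?fin_num_measure//; last exact: measurableC.
    apply: le_measure; rewrite ?inE; [exact: measurableC|exact: measurable_ge_set|].
    by move=> x /= /negP; rewrite -ltNge lerN2 => /ltW.
  by rewrite PC//; move: small; rewrite /upper_tail; lra.
have B_le := integral_excess_le mN (_ : 0 < 51 / 100) lcN tail_m tail_half.
have {}B_le : (\int[P]_x (excess (fun x => - Y x) 2^-1 x)%:E
    <= (2 * (51 / 100) ^+ 2 * 16^-1)%:E)%E by apply: B_le; lra.
have mB := measurable_excess 2^-1 mN.
suff : (1 < 1 :> \bar R)%E by rewrite ltxx.
rewrite -[ltLHS]EY2.
(* From [(w + c) ^ 2 <= 2 w ^ 2 + 2 c ^ 2] at the thresholds [c = 1/100] and [c = 1/2]. The integral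
   comes out below 6/10. *)
apply: (@le_lt_trans _ _ (\int[P]_x (51 / 100 +
    2 * (excess Y 100^-1 x + excess (fun x => - Y x) 2^-1 x))%:E)%E).
  apply: ge0_le_integral => //.
  - by move=> x _; rewrite lee_fin sqr_ge0.
  - exact/measurable_EFinP.
  - apply/measurable_EFinP; apply: measurable_funD => //.
    by apply: measurable_funM => //; exact: measurable_funD.
  - move=> x _; rewrite lee_fin /excess.
    have := sqr_ge0 (Y x - 50^-1); have := sqr_ge0 (Y x + 1).
    have [?|?] := leP (Y x - 100^-1) 0; have [?|?] := leP (- Y x - 2^-1) 0; nra.
rewrite ge0_integral_affine//; first last.
- by move=> x; rewrite addr_ge0 ?excess_ge0.
- exact: measurable_funD.
under eq_integral do rewrite EFinD.
rewrite ge0_integralD//; first last.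
- exact/measurable_EFinP.
- by move=> x _; rewrite lee_fin excess_ge0.
- exact/measurable_EFinP.
- by move=> x _; rewrite lee_fin excess_ge0.
apply: (@le_lt_trans _ _ ((51 / 100)%:E + 2%:E *
    ((2 * (201 / 100) ^+ 2 * (100 * 1000)^-1)%:E + (2 * (51 / 100) ^+ 2 * 16^-1)%:E))%E).
  by rewrite leeD2l// lee_wpmul2l// leeD.
by rewrite -[X in (_ + _ * X)%E]EFinD -EFinM -EFinD lte_fin; lra.
Qed.

End Tails.

(** * Moments of linear functionals and the mass of half-spaces *)

Section HalfSpaces.
Context {R : realType} {n : nat} (mu : probability (borel_rV R n) R).
Implicit Types u : 'rV[R]_n.

Local Notation X i := (fun x : borel_rV R n => (x : 'rV[R]_n) ord0 i).

Lemma measurable_coord i : measurable_fun setT (X i).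
Proof. by apply: continuous_borel => x; exact: coord_continuous. Qed.

Lemma measurable_dot u : measurable_fun setT (dot u : borel_rV R n -> R).
Proof. by apply: continuous_borel; exact: continuous_dot. Qed.

Lemma midpoint_log_concave_dot u : log_concave mu ->
  midpoint_log_concave (upper_tail mu (dot u)).
Proof.
move=> lc s t; apply: logconcave_mid => //.
- exact: measurable_ge_set (measurable_dot u).
- exact: measurable_ge_set (measurable_dot u).
- exact: measurable_ge_set (measurable_dot u).
by move=> a b /= sa tb; rewrite dotZr dotDr ler_pM2l// lerD.
Qed.

Hypothesis iso : isotropic mu.

Lemma integral_coordM i j : (\int[mu]_x (X i x * X j x)%:E = (i == j)%:R%:E)%E.
Proof.
have [E0 C] := iso; rewrite -C covariance.unlock !E0 expectation.unlock.
apply: eq_integral => x _; congr (_%:E).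
by rewrite -[Z in Z * _]subr0 -[Z in _ * Z]subr0.
Qed.

Lemma integrable_coord_sqr i : mu.-integrable setT (EFin \o (fun x => X i x ^+ 2)).
Proof.
apply/integrableP; split.
  by apply/measurable_EFinP; apply: measurable_funX; exact: measurable_coord.
rewrite (eq_integral (fun x => (X i x * X i x)%:E)) => [|x _].
  by rewrite integral_coordM ltry.
by rewrite /= ger0_norm ?sqr_ge0// expr2.
Qed.

Lemma integrable_coordM i j : mu.-integrable setT (EFin \o (fun x => X i x * X j x)).
Proof.
have [mi mj] := (integrable_coord_sqr i, integrable_coord_sqr j).
apply: le_integrable (integrableD measurableT mi mj) => //.
  by apply/measurable_EFinP; apply: measurable_funM; exact: measurable_coord.
move=> x _; rewrite /= lee_fin [leRHS]ger0_norm ?addr_ge0 ?sqr_ge0//.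
rewrite normrM; have := sqr_ge0 (`|x ord0 i| - `|x ord0 j|).
rewrite -(real_normK (num_real (x ord0 i))) -(real_normK (num_real (x ord0 j))).
by move: (normr_ge0 (x ord0 i)) (normr_ge0 (x ord0 j)); nra.
Qed.

Lemma integrable_coord i : mu.-integrable setT (EFin \o X i).
Proof.
have mi := integrable_coord_sqr i.
have m1 : mu.-integrable setT (EFin \o cst (1 : R)).
  exact: finite_measure_integrable_cst.
apply: le_integrable (integrableD measurableT m1 mi) => //.
  by apply/measurable_EFinP; exact: measurable_coord.
move=> x _; rewrite /= lee_fin [leRHS]ger0_norm ?addr_ge0 ?sqr_ge0//.
rewrite -(real_normK (num_real (x ord0 i))).
by move: (normr_ge0 (x ord0 i)); nra.
Qed.

Lemma integral_dot u : (\int[mu]_x (dot u x)%:E = 0)%E.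
Proof.
under eq_integral do rewrite /dot -sumEFin.
rewrite integral_sum//=; last first.
  move=> i; under [fun x => _]eq_fun do rewrite EFinM.
  exact: integrableZl (integrable_coord i).
rewrite big1// => i _; under eq_integral do rewrite EFinM.
rewrite integralZl//; last exact: integrable_coord.
by have [+ _] := iso => /(_ i); rewrite expectation.unlock => ->; rewrite mule0.
Qed.

Lemma integral_dot_sqr u : dot u u = 1 -> (\int[mu]_x (dot u x ^+ 2)%:E = 1)%E.
Proof.
move=> u1.
have int_ij i j : mu.-integrable setT
    (fun x => ((u ord0 i * u ord0 j)%:E * (X i x * X j x)%:E)%E).
  exact: integrableZl (integrable_coordM i j).
under eq_integral => x _.
  rewrite expr2 /dot mulr_suml -sumEFin.
  under eq_bigr => i _ do rewrite mulr_sumr -sumEFin.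
  under eq_bigr => i _ do under eq_bigr => j _ do rewrite mulrACA EFinM.
  over.
rewrite integral_sum//=; last by move=> i; exact: integrable_sum.
rewrite -u1 /dot -sumEFin; apply: eq_bigr => i _.
rewrite integral_sum//= (bigD1 i)//= big1 => [|j ji].
  rewrite integralZl//; last exact: integrable_coordM.
  by rewrite integral_coordM eqxx mule1 adde0.
rewrite integralZl//; last exact: integrable_coordM.
by rewrite integral_coordM eq_sym (negbTE ji) mule0.
Qed.

Lemma halfspace_mass_gt u : log_concave mu -> dot u u = 1 ->
  (100 * 1000)^-1 < upper_tail mu (dot u) 100^-1.
Proof.
move=> lc u1; apply: upper_tail_gt.
- exact: measurable_dot.
- exact: integral_dot.
- exact: integral_dot_sqr.
- exact: midpoint_log_concave_dot.
- rewrite (_ : (fun x => - dot u x) = dot (- u)).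
    exact: midpoint_log_concave_dot.
  by apply/funext => x; rewrite -[- u]scaleN1r dotZl mulN1r.
Qed.

End HalfSpaces.

(** * Mass of small cubes close to the origin *)

Lemma measure_finType_bigcup (d : measure_display) (T : measurableType d)
    (R : realType) (mu : {measure set T -> \bar R}) (I : finType)
    (F : I -> set T) : (forall i, measurable (F i)) ->
  (mu (\bigcup_i F i) <= \sum_i mu (F i))%E.
Proof.
move=> mF.
have -> : \bigcup_i F i = \big[setU/set0]_(i <- index_enum I) F i.
  rewrite -bigcup_seq; apply/seteqP; split=> x [i _ Fx]; exists i => //=.
  by rewrite mem_index_enum.
elim: (index_enum I) => [|i l IH]; first by rewrite !big_nil measure0.
rewrite !big_cons; apply: le_trans (measureU2 _ _ _) _ => //.
  by apply: bigsetU_measurable.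
by rewrite leeD2l.
Qed.

Section CentralBalls.
Context {R : realType} {n : nat} (mu : probability (borel_rV R n) R).
Implicit Types (x y z : 'rV[R]_n) (r : R).
Local Notation m A := (fine (mu A)).

Lemma measurable_row_ball x r : measurable (ball x r : set (borel_rV R n)).
Proof. by apply: open_borel; exact: ball_open. Qed.

(** The supremum of the masses need not be attained, so a centre reaching half of it is taken. *)
Lemma exists_near_max_ball r :
  exists x0, forall y, m (ball y r) <= 2 * m (ball x0 r).
Proof.
pose E := [set m (ball y r) | y in [set: 'rV[R]_n]].
have hE : has_sup E.
  split; first by exists (m (ball 0 r)); exists 0.
  by exists 1 => _ [y _ <-]; apply: mass_le1; exact: measurable_row_ball.
have leE y : m (ball y r) <= sup E by apply: (sup_upper_bound hE); exists y.
have [E0|E0] := leP (sup E) 0.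
  exists 0 => y; rewrite (le_trans (leE y))// (le_trans E0)// mulr_ge0//.
  exact: mass_ge0.
have /(sup_adherent)/(_ hE) : 0 < sup E / 2 by lra.
move=> [_ [x0 _ <-]] lt0; exists x0 => y.
apply: le_trans (leE y) _; lra.
Qed.

Hypothesis lc : log_concave mu.

(** Log-concavity bounds the mass below by [k ^ t * k ^ (1 - t) = k]. *)
Lemma cvx_heavy_balls r (k : R) : 0 < r ->
  cvx [set z : 'rV[R]_n | k <= m (ball z r)].
Proof.
move=> r0 x y t /= kx ky; have [k0 _|k0] := leP k 0.
  exact: le_trans k0 (mass_ge0 _ _).
rewrite le_eqVlt => /andP[/orP[/eqP <-|t0] t1].
  by rewrite scale0r add0r subr0 scale1r.
move: t1; rewrite le_eqVlt => /orP[/eqP ->|t1].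
  by rewrite subrr scale0r addr0 scale1r.
have t01 : 0 < t < 1 by rewrite t0.
have t1' : 0 <= 1 - t by lra.
apply: le_trans (logconcave_mass lc (measurable_row_ball x r)
  (measurable_row_ball y r) _ t01 _); last 2 first.
- exact: measurable_row_ball.
- move=> a b /(row_ballP _ _ r0) xa /(row_ballP _ _ r0) yb.
  apply/(row_ballP _ _ r0) => i; rewrite !mxE.
  rewrite (_ : _ - _ = t * (x ord0 i - a ord0 i)
                     + (1 - t) * (y ord0 i - b ord0 i)); last by ring.
  by apply: norm_conv_lt; rewrite ?(ltW t0) ?(ltW t1).
rewrite -[leLHS](powRr1 (ltW k0)) -[in leLHS](subrK t 1) addrC.
rewrite powRD ?(gt_eqF k0) ?implybT//.
by apply: ler_pM; rewrite ?powR_ge0 ?ge0_ler_powR ?nnegrE ?(ltW t0) ?(ltW k0)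
  ?mass_ge0.
Qed.

(** With [u], [v], [w] the masses of the ball at [y], the ball at [x0] and the half-way ball,
    log-concavity gives [u * v <= w ^ 2], and lightness turns this into [u ^ 2 <= c ^ 2 * w ^ 2].
    The half-way radius is the mean of [r] and [4 r]. *)
Lemma mass_light_ball x0 y r (c : R) : 0 < r -> 0 <= c ->
  m (ball y r) < c ^+ 2 * m (ball x0 (4 * r)) ->
  m (ball y r) <= c * m (ball (2^-1 *: (y + x0)) (5 / 2 * r)).
Proof.
move=> r0 c0 lt_c; have r4 : 0 < 4 * r by lra.
have r5 : 0 < 5 / 2 * r by lra.
have : m (ball y r) * m (ball x0 (4 * r))
    <= m (ball (2^-1 *: (y + x0)) (5 / 2 * r)) ^+ 2.
  apply: logconcave_mid; rewrite ?measurable_row_ball//.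
  - exact: measurable_row_ball.
  - exact: measurable_row_ball.
  - exact: measurable_row_ball.
  move=> a b /(row_ballP _ _ r0) ya /(row_ballP _ _ r4) xb.
  apply/(row_ballP _ _ r5) => i; rewrite !mxE.
  move: (ya i) (xb i); rewrite !ltr_norml => /andP[? ?] /andP[? ?].
  by apply/andP; split; lra.
move: lt_c (mass_ge0 mu (ball y r)) (mass_ge0 mu (ball x0 (4 * r))).
move: (mass_ge0 mu (ball (2^-1 *: (y + x0)) (5 / 2 * r))).
move: (m (ball y r)) (m (ball x0 _)) (m (ball (_ *: _) _)) => u v w.
move=> w0 lt_c u0 v0 uv.
rewrite -(@ler_pXn2r _ 2) ?nnegrE ?mulr_ge0// exprMn.
apply: (@le_trans _ _ (c ^+ 2 * (u * v))); last by rewrite ler_wpM2l ?sqr_ge0.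
by rewrite mulrCA expr2 ler_wpM2l// ltW.
Qed.

(** A grid of mesh [r] with each index split into a residue [s] modulo 10 and a quotient [j]. For
    fixed [s], half-way centres are at least [5 r] apart, twice the half-way radius. *)
Definition grid_point r (s : {ffun 'I_n -> 'I_10}) (j : {ffun 'I_n -> int}) :
  'rV[R]_n := \row_i (r * (10 * (j i)%:~R + (s i)%:R)).

Definition grid_cell r s j : set 'rV[R]_n :=
  [set x | forall i, grid_point r s j ord0 i <= x ord0 i < grid_point r s j ord0 i + r].

Lemma grid_cell_cover r x : 0 < r -> exists s j, grid_cell r s j x.
Proof.
move=> r0; pose j := [ffun i => Num.floor (x ord0 i / (10 * r))].
(* The truncated offset is below 10, so [inord] never falls back to its default. *)
pose s := [ffun i =>
  inord (Num.trunc (x ord0 i / r - 10 * (j i)%:~R)) : 'I_10].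
exists s, j => i; rewrite mxE.
have /andP[] := floor_itv (x ord0 i / (10 * r)).
rewrite -/(j i) (_ : Num.floor _ = j i); last by rewrite ffunE.
rewrite intrD; set q : R := (j i)%:~R => j1 j2.
have r10 : 0 < 10 * r by lra.
move: j1 j2; rewrite ler_pdivlMr// ltr_pdivrMr// => j1 j2.
set y := x ord0 i / r - 10 * q.
have xE : x ord0 i = r * (10 * q + y) by rewrite /y; field; lra.
rewrite xE in j1 j2 *.
have y0 : 0 <= y by rewrite -(ler_pM2l r0); lra.
have y10 : y < 10 by rewrite -(ltr_pM2l r0); lra.
have /andP[t1 t2] := truncn_itv y0.
have -> : (s i)%:R = (Num.trunc y)%:R :> R.
  rewrite ffunE -/q inordK// -(ltr_nat R); exact: le_lt_trans t1 y10.
move: t2; rewrite -natr1 => t2.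
by apply/andP; split; nra.
Qed.

Lemma measurable_grid_cell r s j :
  measurable (grid_cell r s j : set (borel_rV R n)).
Proof.
rewrite (_ : grid_cell r s j = \bigcap_(i in [set: 'I_n])
  ((fun x : borel_rV R n => (x : 'rV[R]_n) ord0 i) @^-1`
     `[grid_point r s j ord0 i, grid_point r s j ord0 i + r[%classic)); last first.
  apply/seteqP; split=> [x h i _|x h i]; first by rewrite /= in_itv /=; exact: h.
  by have := h i I; rewrite /= in_itv /=.
apply: fin_bigcap_measurable => // i _.
by rewrite -[_ @^-1` _]setTI; apply: measurable_coord.
Qed.

Lemma grid_cell_sub_ball r s j : 0 < r -> grid_cell r s j `<=` ball (grid_point r s j) r.
Proof.
move=> r0 x h; apply/(row_ballP _ _ r0) => i; have /andP[? ?] := h i.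
by rewrite ltr_norml; apply/andP; split; lra.
Qed.

(** The exceptional set: any point outside it lies in a cell whose corner is the centre of a heavy
    ball. *)
Definition light_cells x0 r (c : R) : set 'rV[R]_n :=
  \bigcup_s \bigcup_j
    (if m (ball (grid_point r s j) r) < c ^+ 2 * m (ball x0 (4 * r))
     then grid_cell r s j else set0).

Lemma light_cells_measurable x0 r c :
  measurable (light_cells x0 r c : set (borel_rV R n)).
Proof.
apply: fin_bigcup_measurable => // s _.
apply: countable_bigcupT_measurable => // j.
by case: ifP => _; [exact: measurable_grid_cell|exact: measurable0].
Qed.

(* The half-way balls to [x0] are disjoint within each residue class of the
   grid modulo [10]. *)
Lemma light_cells_mass x0 r c : 0 < r -> 0 <= c ->
  (mu (light_cells x0 r c) <= (10 ^+ n * c)%:E)%E.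
Proof.
move=> r0 c0.
have mcell s j : measurable ((if m (ball (grid_point r s j) r)
      < c ^+ 2 * m (ball x0 (4 * r)) then grid_cell r s j else set0)
    : set (borel_rV R n)).
  by case: ifP => _; [exact: measurable_grid_cell|exact: measurable0].
apply: (@le_trans _ _ (\sum_(s : {ffun 'I_n -> 'I_10}) c%:E)%E); last first.
  rewrite sumEFin lee_fin sumr_const card_ffun !card_ord.
  by rewrite -(mulr_natl c) natrX.
apply: le_trans (measure_finType_bigcup _ _) _.
  by move=> s; apply: countable_bigcupT_measurable => // j; exact: mcell.
apply: lee_sum => s _.
pose Y j : set (borel_rV R n) :=
  ball (2^-1 *: (grid_point r s j + x0)) (5 / 2 * r).
have mY j : measurable (Y j) by exact: measurable_row_ball.
have r5 : 0 < 5 / 2 * r by lra.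
apply: (@le_trans _ _ (c%:E * mu (\bigcup_j Y j))%E); last first.
  rewrite -[leRHS]mule1 lee_wpmul2l// probability_le1//.
  by apply: countable_bigcupT_measurable => // j; exact: mY.
apply: measure_bigcup_le => //.
- move=> j j' _ _ [x []] /(row_ballP _ _ r5) jx /(row_ballP _ _ r5) j'x.
  apply/ffunP => i; move: (jx i) (j'x i); rewrite !mxE !ltr_norml.
  move=> /andP[h1 h2] /andP[h3 h4].
  have lt1 : r * ((j i)%:~R - (j' i)%:~R) < r * 1 by lra.
  have lt2 : r * ((j' i)%:~R - (j i)%:~R) < r * 1 by lra.
  move: lt1 lt2; rewrite !ltr_pM2l// -!intrB -[1]/(1%:~R) !ltr_int; lia.
- move=> j; case: ifP => [lt_c|_]; last first.
    by rewrite measure0 mule_ge0.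
  apply: (@le_trans _ _ (mu (ball (grid_point r s j) r))).
    by apply: le_measure; rewrite ?inE; [exact: measurable_grid_cell
      |exact: measurable_row_ball|exact: grid_cell_sub_ball].
  rewrite -[leLHS]fineK ?fin_num_measure//; last exact: measurable_row_ball.
  rewrite -[X in (_ * X)%E]fineK ?fin_num_measure// -EFinM lee_fin.
  exact: mass_light_ball.
Qed.

Hypothesis iso : isotropic mu.

(** For [c = s ^ n] the light cells have mass at most [(10 s) ^ n], too little to contain a
    half-space at distance 1/100 from the origin. This puts [z] in the closure of the convex set [L]
    of heavy centres. *)
Lemma central_ball_mass (s : R) r z y : 0 < s -> 10 * s <= (100 * 1000)^-1 ->
  (0 < n)%N -> 0 < r -> n%:R * r < 200^-1 ->
  (forall u, dot u u = 1 -> dot u z <= 200^-1) ->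
  (s ^+ n) ^+ 2 / 2 * m (ball y (4 * r)) <= m (ball z (2 * r)).
Proof.
move=> s0 s10 n0 r0 nr zu; set c := s ^+ n.
have c0 : 0 < c by rewrite exprn_gt0.
have [x0 maxx0] := exists_near_max_ball (4 * r).
pose L := [set z : 'rV[R]_n | c ^+ 2 * m (ball x0 (4 * r)) <= m (ball z r)].
pose B := light_cells x0 r c.
have mB := light_cells_measurable x0 r c.
have B_le : m B <= (100 * 1000)^-1.
  rewrite -lee_fin fineK ?fin_num_measure//.
  apply: le_trans (light_cells_mass _ r0 (ltW c0)) _.
  rewrite lee_fin /c -exprMn; apply: le_trans (s10).
  have s1 : 10 * s <= 1 by apply: le_trans s10 _; lra.
  by rewrite -[leRHS]expr1 ler_wiXn2l// mulr_ge0// ltW.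
have LB x : ~ B x -> exists2 z', L z' & forall i, z' ord0 i <= x ord0 i < z' ord0 i + r.
  move=> nBx; have [k [j cx]] := grid_cell_cover x r0.
  exists (grid_point r k j) => //.
  rewrite /L /= leNgt; apply/negP => lt_c; apply: nBx.
  by exists k => //; exists j => //; rewrite lt_c.
have L0 : L !=set0.
  have [x nBx] : exists x, ~ B x.
    apply: contrapT => /forallNP h; move: B_le.
    rewrite (_ : B = setT); last by apply/seteqP; split=> // x _; exact: contrapT (h x).
    by rewrite probability_setT /=; lra.
  by have [z' Lz' _] := LB x nBx; exists z'.
have clz : closure L z.
  (* Otherwise a unit vector [u] separates [z] from [L]. Points outside [B] then have
     [dot u x <= 1/200 + n r < 1/100], so [B] contains the half-space. *)
  apply: contrapT => nz.
  have cvL : cvx L by exact: cvx_heavy_balls.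
  have [u u1 hu] : exists2 u, dot u u = 1 & forall x, closure L x -> dot u x <= dot u z.
    apply: separation => //; [exact: closed_closure|exact: cvx_closure|].
    by have [z' Lz'] := L0; exists z'; exact: subset_closure.
  have := halfspace_mass_gt iso lc u1; apply/negP; rewrite -leNgt.
  apply: le_trans B_le; apply: mass_le => //.
    exact: measurable_ge_set (measurable_dot u).
  move=> x /= ux; apply: contrapT => /LB[z' Lz' zx].
  have uz' := hu _ (subset_closure Lz').
  suff : dot u x <= dot u z' + n%:R * r by move: (zu _ u1); lra.
  rewrite -lerBlDl -dotBr /dot.
  have -> : n%:R * r = \sum_(i < n) r.
    by rewrite sumr_const card_ord mulr_natl.
  apply: ler_sum => i _; rewrite !mxE.
  have := sqr_coord_le u i; rewrite u1 => ui.
  have ui1 : u ord0 i <= 1 by nra.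
  have /andP[? ?] := zx i; nra.
(* A heavy centre within [r] of [z]; its ball of radius [r] lies in the ball of radius [2 r] at
   [z]. *)
have [z' [Lz' /(row_ballP _ _ r0) zz']] := clz _ (nbhsx_ballx z r r0).
have r2 : 0 < 2 * r by lra.
apply: (@le_trans _ _ (m (ball z' r))); last first.
  apply: mass_le; [exact: measurable_row_ball|exact: measurable_row_ball|].
  move=> x /(row_ballP _ _ r0) z'x; apply/(row_ballP _ _ r2) => i.
  move: (zz' i) (z'x i); rewrite !ltr_norml => /andP[? ?] /andP[? ?].
  by apply/andP; split; lra.
apply: le_trans Lz'; rewrite -mulrA ler_wpM2l ?sqr_ge0//.
by have := maxx0 y; lra.
Qed.

End CentralBalls.

(** * Contraction towards a point close to the origin *)

Section Contraction.
Context {R : realType} {n : nat} (mu : probability (borel_rV R n) R).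
Implicit Types (x y z : 'rV[R]_n) (K : set 'rV[R]_n) (r l : R).
Local Notation m A := (fine (mu A)).
Local Notation msr A := (measurable (A : set (borel_rV R n))).

Lemma trivIset_mass_le (N : nat) (F : 'I_N -> set 'rV[R]_n) A (c : R) :
  (forall i, msr (F i)) -> msr A -> trivIset setT F ->
  (forall i, F i `<=` A) -> (forall i, c <= m (F i)) -> N%:R * c <= m A.
Proof.
move=> mF mA tF FA cF.
apply: (@le_trans _ _ (\sum_(i < N) m (F i))).
  rewrite mulr_natl -[N in c *+ N]card_ord -sumr_const.
  by apply: ler_sum => i _; exact: cF.
rewrite -lee_fin -sumEFin.
under eq_bigr => i _ do rewrite fineK ?fin_num_measure//.
rewrite -(@measure_bigsetU_ord _ _ _ mu N xpredT F)// fineK ?fin_num_measure//.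
apply: le_measure; rewrite ?inE//; first exact: bigsetU_measurable.
by rewrite -bigcup_seq => x [i _ Fx]; exact: FA Fx.
Qed.

(** The open [r]-neighbourhood of [(1 - l) K + l z]; being open, it is Borel for every [K]. *)
Definition shrink l z r K : set 'rV[R]_n :=
  \bigcup_(a in K) ball ((1 - l) *: a + l *: z) r.

Lemma open_shrink l z r K : open (shrink l z r K).
Proof. by apply: bigcup_open => a _; exact: ball_open. Qed.

Lemma measurable_shrink l z r K : msr (shrink l z r K).
Proof. by apply: open_borel; exact: open_shrink. Qed.

Hypothesis n0 : (0 < n)%N.

(** Along coordinate [i], each period [8 r] splits into [2 n] slots of width [4 r / n]. One residue
    [k] per coordinate will be discarded to create the gaps. *)
Definition slot_set r (i : 'I_n) (k : 'I_(2 * n)) : set 'rV[R]_n :=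
  \bigcup_(j : int) [set x |
    8 * r * j%:~R + k%:R * (4 * r / n%:R) <= x ord0 i <
    8 * r * j%:~R + k.+1%:R * (4 * r / n%:R)].

Lemma measurable_slot_set r i k : msr (slot_set r i k).
Proof.
apply: countable_bigcupT_measurable => // j.
rewrite -[X in measurable X]setTI.
have := measurable_coord i measurableT
  (measurable_itv `[8 * r * j%:~R + k%:R * (4 * r / n%:R),
    8 * r * j%:~R + k.+1%:R * (4 * r / n%:R)[).
by congr measurable; apply/seteqP; split=> x /=; rewrite in_itv.
Qed.

Lemma slot_set_disjoint r i k k' x : 0 < r ->
  slot_set r i k x -> slot_set r i k' x -> k = k'.
Proof.
move=> r0 [j _ /= jx] [j' _ /= jx'].
have n0' : (0 : R) < n%:R by rewrite ltr0n.
set w := 4 * r / n%:R in jx jx'.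
have w0 : 0 < w by rewrite divr_gt0// mulr_gt0.
have rw : 8 * r = (2 * n)%:R * w.
  by rewrite natrM /w; field; rewrite gt_eqF.
move: jx jx'; rewrite rw => /andP[h1 h2] /andP[h3 h4].
have e1 : w * ((2 * n)%:R * j%:~R + k%:R) < w * ((2 * n)%:R * j'%:~R + k'.+1%:R) by lra.
have e2 : w * ((2 * n)%:R * j'%:~R + k'%:R) < w * ((2 * n)%:R * j%:~R + k.+1%:R) by lra.
move: e1 e2; rewrite !ltr_pM2l// !pmulrn -!intrM -!intrD !ltr_int => e1 e2.
apply: val_inj => /=; move: e1 e2 (ltn_ord k) (ltn_ord k').
move: (2 * n)%N (nat_of_ord k) (nat_of_ord k') => N a b e1 e2 aN bN.
have [jj'|jj'|jj'] := ltgtP j j'.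
- have : (N%:Z * (j + 1) <= N%:Z * j')%R by apply: ler_wpM2l => //; lia.
  lia.
- have : (N%:Z * (j' + 1) <= N%:Z * j)%R by apply: ler_wpM2l => //; lia.
  lia.
by move: e1 e2; rewrite jj'; lia.
Qed.

(** Pigeonhole on the [2 n] disjoint slots. Discarding one per coordinate thus costs at most half of
    the mass of [K]. *)
Lemma exists_light_slot r i K : 0 < r -> msr K ->
  exists k, (2 * n)%:R * m (K `&` slot_set r i k) <= m K.
Proof.
move=> r0 mK; have n20 : (0 < 2 * n)%N by rewrite muln_gt0.
have mKs k : msr (K `&` slot_set r i k).
  by apply: measurableI => //; exact: measurable_slot_set.
case: (@Order.TotalTheory.arg_minP _ _ _ (Ordinal n20) xpredT
  (fun k => m (K `&` slot_set r i k)) isT) => k _ mink.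
exists k; apply: (@trivIset_mass_le _ (fun k => K `&` slot_set r i k)) => //.
- by move=> a b _ _ [x [[_ ax] [_ bx]]]; exact: slot_set_disjoint ax bx.
- by move=> k'; exact: (mink k' isT).
Qed.

(** The boxes left between discarded slots of consecutive periods. *)
Definition gap_cell r (k : 'I_n -> 'I_(2 * n)) (j : {ffun 'I_n -> int}) :
    set 'rV[R]_n :=
  [set x | forall i,
    8 * r * (j i)%:~R + (k i).+1%:R * (4 * r / n%:R) <= x ord0 i <
    8 * r * ((j i)%:~R + 1) + (k i)%:R * (4 * r / n%:R)].

Lemma measurable_gap_cell r k j : msr (gap_cell r k j).
Proof.
rewrite (_ : gap_cell r k j = \bigcap_(i in [set: 'I_n])
  ((fun x : borel_rV R n => (x : 'rV[R]_n) ord0 i) @^-1`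
    `[8 * r * (j i)%:~R + (k i).+1%:R * (4 * r / n%:R),
      8 * r * ((j i)%:~R + 1) + (k i)%:R * (4 * r / n%:R)[%classic)); last first.
  apply/seteqP; split=> [x h i _|x h i]; first by rewrite /= in_itv /=; exact: h.
  by have := h i I; rewrite /= in_itv /=.
apply: fin_bigcap_measurable => // i _.
by rewrite -[_ @^-1` _]setTI; apply: measurable_coord.
Qed.

Lemma gap_cell_cover r k x : 0 < r -> (forall i, ~ slot_set r i (k i) x) ->
  exists j, gap_cell r k j x.
Proof.
move=> r0 nslot; set w := 4 * r / n%:R in nslot *.
exists [ffun i => Num.floor ((x ord0 i - (k i)%:R * w) / (8 * r))] => i.
rewrite ffunE; set j := Num.floor _.
have /andP[] := floor_itv ((x ord0 i - (k i)%:R * w) / (8 * r)).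
have r8 : 0 < 8 * r by lra.
rewrite -/j intrD ler_pdivlMr// ltr_pdivrMr// => j1 j2.
apply/andP; split; last by rewrite -/w; lra.
rewrite -/w leNgt; apply/negP => lt; apply: (nslot i); exists j => //=.
by apply/andP; split; rewrite -/w; lra.
Qed.

Lemma gap_cell_sub_ball r k j : 0 < r ->
  exists y, gap_cell r k j `<=` ball y (4 * r).
Proof.
move=> r0; have r4 : 0 < 4 * r by lra.
have n0' : (0 : R) < n%:R by rewrite ltr0n.
set w := 4 * r / n%:R; have w0 : 0 < w by rewrite divr_gt0// mulr_gt0.
exists (\row_i (8 * r * (j i)%:~R + (k i)%:R * w + 4 * r + w / 2)).
move=> x h; apply/(row_ballP _ _ r4) => i; rewrite mxE.
have := h i; rewrite -/w -(natr1 (k i)) => /andP[? ?].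
by rewrite ltr_norml; apply/andP; split; lra.
Qed.

(** The gap [8 r l] contracts to at least [4 r l], the sum of the two radii [2 r l]. *)
Lemma shrink_disjoint r l k z j j' p : 0 < r -> l = (2 * n)%:R^-1 ->
  shrink l z (l * (2 * r)) (gap_cell r k j) p ->
  shrink l z (l * (2 * r)) (gap_cell r k j') p -> j = j'.
Proof.
move=> r0 lE.
have n0' : (1 : R) <= n%:R by rewrite ler1n.
have l0 : 0 < l by rewrite lE invr_gt0 ltr0n muln_gt0.
have l2 : l <= 2^-1.
  by rewrite lE lef_pV2 ?posrE ?ltr0n ?muln_gt0// natrM; lra.
set w := 4 * r / n%:R.
have wE : w = 8 * r * l by rewrite /w lE natrM; field; rewrite gt_eqF//; lra.
have rl : 0 < l * (2 * r) by rewrite mulr_gt0//; lra.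
move=> [a aj /(row_ballP _ _ rl) ap] [a' aj' /(row_ballP _ _ rl) a'p].
apply/ffunP => i; move: (aj i) (aj' i) (ap i) (a'p i); rewrite -/w !mxE.
rewrite -(natr1 (k i)) !ltr_norml => /andP[h1 h2] /andP[h3 h4] /andP[h5 h6] /andP[h7 h8].
have key (b c : 'rV[R]_n) (u v : int) :
    8 * r * u%:~R + ((k i)%:R + 1) * w <= b ord0 i ->
    c ord0 i < 8 * r * (v%:~R + 1) + (k i)%:R * w ->
    (1 - l) * b ord0 i < (1 - l) * c ord0 i + 4 * (l * r) -> (u < v + 1)%R.
  move=> hb hc hbc; rewrite -(ltr_int R) intrD -(@ltr_pM2l _ (8 * r)); last by lra.
  have l1 : 0 < 1 - l by lra.
  rewrite -(ltr_pM2l l1).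
  have q1 : (1 - l) * (8 * r * u%:~R + ((k i)%:R + 1) * w) <= (1 - l) * b ord0 i.
    by rewrite ler_pM2l.
  have q2 : (1 - l) * c ord0 i < (1 - l) * (8 * r * (v%:~R + 1) + (k i)%:R * w).
    by rewrite ltr_pM2l.
  have q3 : 4 * (l * r) <= (1 - l) * w by rewrite wE; nra.
  by move: q1 q2 q3; rewrite !mulrDr; lra.
have jj' : (j i < j' i + 1)%R by apply: key h1 h4 _; lra.
have j'j : (j' i < j i + 1)%R by apply: key h3 h2 _; lra.
by apply/eqP; rewrite eq_le -!ltzD1 jj' j'j.
Qed.

Hypothesis lc : log_concave mu.

(** Each piece of [K] in a gap cell fits in a ball of radius [4 r], so [logconcave_contract] applies
    to it and the ball at [z]. The contracted pieces are disjoint, and the factor 2 pays for the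
    discarded slots. *)
Lemma contraction_mass r l z (k0 : R) K : 0 < r -> l = (2 * n)%:R^-1 ->
  0 < k0 ->
  (forall y, k0 * m (ball y (4 * r)) <= m (ball z (2 * r))) -> msr K ->
  k0 `^ l * m K <= 2 * m (shrink l z (l * (2 * r)) K).
Proof.
move=> r0 lE k00 zmax mK.
have n0' : (1 : R) <= n%:R by rewrite ler1n.
have l0 : 0 < l by rewrite lE invr_gt0 ltr0n muln_gt0.
have l2 : l <= 2^-1.
  by rewrite lE lef_pV2 ?posrE ?ltr0n ?muln_gt0// natrM; lra.
have l01 : 0 < l < 1 by rewrite l0; lra.
have rl : 0 < l * (2 * r) by rewrite mulr_gt0//; lra.
have r2 : 0 < 2 * r by lra.
have k0l : 0 < k0 `^ l by rewrite powR_gt0.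
have [k hk] := fin_all_exists (fun i => exists_light_slot i r0 mK).
have mslot i : msr (K `&` slot_set r i (k i)).
  by apply: measurableI => //; exact: measurable_slot_set.
have mcell j : msr (K `&` gap_cell r k j).
  by apply: measurableI => //; exact: measurable_gap_cell.
pose C := \bigcup_j (K `&` gap_cell r k j).
have mC : msr C by apply: countable_bigcupT_measurable.
have half : m K <= 2 * m C.
  pose S := \bigcup_(i : 'I_n) (K `&` slot_set r i (k i)).
  have mS : msr S by apply: fin_bigcup_measurable.
  have S_le : m S <= m K / 2.
    have : (mu S <= (\sum_(i < n) (m K / (2 * n)%:R))%:E)%E.
      apply: le_trans (measure_finType_bigcup _ _) _ => //.
      rewrite -sumEFin; apply: lee_sum => i _.
      rewrite -[leLHS]fineK ?fin_num_measure// lee_fin.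
      by rewrite ler_pdivlMr ?ltr0n ?muln_gt0// mulrC; exact: hk.
    rewrite sumr_const card_ord -[leLHS]fineK ?fin_num_measure// lee_fin.
    suff -> : (m K / (2 * n)%:R) *+ n = m K / 2 by [].
    by rewrite -mulr_natr natrM; field; rewrite gt_eqF//; lra.
  have : (mu K <= mu C + mu S)%E.
    apply: le_trans (measureU2 _ _ _) => //.
    apply: le_measure; rewrite ?inE//; first exact: measurableU.
    move=> x Kx; have [[i hi]|/forallNP ns] := pselect (exists i, slot_set r i (k i) x).
      by right; exists i.
    by have [j jx] := gap_cell_cover r0 ns; left; exists j.
  rewrite -[leLHS]fineK -1?[mu C]fineK -1?[mu S]fineK ?fin_num_measure//.
  by rewrite -EFinD lee_fin; lra.
pose Y j := shrink l z (l * (2 * r)) (K `&` gap_cell r k j).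
have : (mu C <= (k0 `^ l)^-1%:E * mu (\bigcup_j Y j))%E.
  apply: measure_bigcup_le => //.
  - by rewrite invr_ge0 powR_ge0.
  - by move=> j; exact: measurable_shrink.
  - move=> j j' _ _ [p [[a [_ aj] ap] [a' [_ aj'] a'p]]].
    by apply: (@shrink_disjoint r l k z j j' p r0 lE); [exists a|exists a'].
  move=> j; rewrite -[leLHS]fineK ?fin_num_measure//.
  rewrite -[X in (_ * X)%E]fineK ?fin_num_measure//; last exact: measurable_shrink.
  rewrite -EFinM lee_fin ler_pdivlMl//.
  apply: (@logconcave_contract _ _ mu _ (ball z (2 * r)) (Y j) l k0 lc) => //.
  - exact: measurable_row_ball.
  - exact: measurable_shrink.
  - exact: ltW.
  - move=> a b aj /(row_ballP _ _ r2) zb; exists a => //.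
    apply/(row_ballP _ _ rl) => i; rewrite !mxE.
    by rewrite opprD addrACA subrr add0r -mulrBr normrM gtr0_norm// ltr_pM2l.
  have [y hy] := gap_cell_sub_ball k j r0.
  apply: le_trans (zmax y); rewrite ler_pM2l//.
  by apply: mass_le => //; [exact: measurable_row_ball|move=> x [_ /hy]].
have mY : msr (\bigcup_j Y j).
  by apply: countable_bigcupT_measurable => // j; exact: measurable_shrink.
rewrite -[leLHS]fineK ?fin_num_measure// -[X in (_ * X)%E]fineK ?fin_num_measure//.
rewrite -EFinM lee_fin ler_pdivlMl// => le_C.
have : m (\bigcup_j Y j) <= m (shrink l z (l * (2 * r)) K).
  apply: mass_le => //; first exact: measurable_shrink.
  by move=> p [j _ [a [Ka _] ap]]; exists a.
have : k0 `^ l * m K <= k0 `^ l * (2 * m C) by rewrite ler_pM2l.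
by lra.
Qed.

End Contraction.

(** * Rims of convex sets *)

Lemma convex_set_cvx (R : realType) (n : nat) (Q : set 'rV[R]_n) :
  convex_set (Q : set (convex_lmodType 'rV[R]_n)) -> cvx Q.
Proof.
move=> cQ x y t Qx Qy /andP[t0 t1].
by have := cQ x y (Itv01 t0 t1); rewrite !inE; apply.
Qed.

Section RimMass.
Context {R : realType} {n : nat} (mu : probability (borel_rV R n) R).
Implicit Types (x y z v : 'rV[R]_n) (C K : set 'rV[R]_n) (e : R).
Local Notation m A := (fine (mu A)).
Local Notation msr A := (measurable (A : set (borel_rV R n))).
Local Notation e_ i := (delta_mx ord0 i : 'rV[R]_n).

Lemma continuous_addr v : continuous (fun x => x + v).
Proof.
by move=> x; apply: (@cvgD R _ _ (nbhs x) _ id (cst v) x v);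
  [exact: cvg_id|exact: cvg_cst].
Qed.

Lemma measurable_rim C v : closed C -> msr (rim C v).
Proof.
move=> clC; apply: measurableD; first exact: closed_borel.
apply: closed_borel; apply: (@preimage_closed _ _ (fun x => x + v) C) => //.
by move=> x _; exact: continuous_addr.
Qed.

(** Keeping [x + v] at sup-distance at least [d] from [C] leaves room for the radius of [shrink]. *)
Definition deep_rim C v (d : R) : set 'rV[R]_n :=
  [set x | C x /\ forall y, C y -> ~ ball y d (x + v)].

Lemma closed_deep_rim C v d : closed C -> closed (deep_rim C v d).
Proof.
move=> clC.
have -> : deep_rim C v d =
    C `&` (fun x => x + v) @^-1` (~` \bigcup_(y in C) ball y d).
  apply/seteqP; split=> x [Cx h]; split=> //; first by move=> [y Cy]; exact: h.
  by move=> y Cy yx; apply: h; exists y.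
apply: closedI => //; apply: preimage_closed.
  by move=> x _; exact: continuous_addr.
by apply: open_closedC; apply: bigcup_open => y _; exact: ball_open.
Qed.

Lemma rim_bigcup_deep C v : closed C ->
  rim C v = \bigcup_k deep_rim C v k.+1%:R^-1.
Proof.
move=> clC; apply/seteqP; split=> [x [Cx nC]|x [k _ [Cx h]]]; last first.
  by split=> // Cv; apply: (h _ Cv); exact: ballxx.
have /nbhs_ballP[d /= d0 dC] : nbhs (x + v) (~` C).
  by apply: open_nbhs_nbhs; split=> //; exact: closed_openC.
exists (Num.trunc d^-1) => //; split=> // y Cy /ball_sym xy.
apply: (dC y) => //; apply: le_ball xy.
have d'0 : 0 <= d^-1 by rewrite invr_ge0 ltW.
have /andP[_ lt_d] := truncn_itv d'0.
by rewrite -[leRHS]invrK lef_pV2 ?posrE ?invr_gt0// ltW.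
Qed.

(* If two shrunk copies of a deep rim, translated along [v] by different
   amounts, had a common point, then by convexity [C] would come close to
   [a' + v] for some [a'] in the deep rim. *)
Lemma deep_rim_shrink_disjoint C v (d r l : R) (k k' : nat) p : cvx C ->
  0 < l <= 2^-1 -> 0 < r -> 4 * r <= d -> (k < k')%N ->
  shrink l ((k%:R * ((1 - l) / l)) *: v) r (deep_rim C v d) p ->
  shrink l ((k'%:R * ((1 - l) / l)) *: v) r (deep_rim C v d) p -> False.
Proof.
move=> cvC /andP[l0 l2] r0 rd kk' [a [Ca _] /(row_ballP _ _ r0) ap].
move=> [a' [Ca' ha'] /(row_ballP _ _ r0) a'p].
have l1 : 0 < 1 - l by lra.
have d0 : 0 < d by lra.
(* A common point forces [a - a'] to be nearly [q v], so the point at fraction [1 / q] from [a'] to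
   [a] is nearly [a' + v]. The error satisfies [(1 - l) * |D| < 2 r], hence [|D| < 4 r <= d]. *)
pose q : R := k'%:R - k%:R.
have q1 : 1 <= q by rewrite /q -natrB 1?ltnW// ler1n subn_gt0.
have q0 : 0 < q by lra.
have t01 : 0 <= q^-1 <= 1 by rewrite invr_ge0 (ltW q0) invf_le1.
apply: (ha' _ (cvC _ _ _ Ca Ca' t01)); apply/(row_ballP _ _ d0) => i.
move: (ap i) (a'p i); rewrite !mxE !ltr_norml => /andP[h1 h2] /andP[h3 h4].
have e1 : l * (k%:R * ((1 - l) / l) * v ord0 i) = k%:R * (1 - l) * v ord0 i.
  by field; rewrite gt_eqF.
have e2 : l * (k'%:R * ((1 - l) / l) * v ord0 i) = k'%:R * (1 - l) * v ord0 i.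
  by field; rewrite gt_eqF.
rewrite e1 in h1 h2; rewrite e2 in h3 h4.
set D := a ord0 i - a' ord0 i - q * v ord0 i.
have D1 : (1 - l) * D < 2 * r by rewrite /D /q; lra.
have D2 : - (2 * r) < (1 - l) * D by rewrite /D /q; lra.
have D3 : `|D| < d.
  by rewrite ltr_norml; apply/andP; split; nra.
have -> : q^-1 * a ord0 i + (1 - q^-1) * a' ord0 i - (a' ord0 i + v ord0 i)
    = q^-1 * D by rewrite /D; field; rewrite gt_eqF.
rewrite -ltr_norml normrM ger0_norm ?invr_ge0 ?(ltW q0)//.
apply: le_lt_trans D3; rewrite ler_piMl//.
by case/andP: t01.
Qed.

Hypothesis n0 : (0 < n)%N.
Hypothesis lc : log_concave mu.
Hypothesis iso : isotropic mu.
Context (s : R) (s0 : 0 < s) (s10 : 10 * s <= (100 * 1000)^-1).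

Lemma deep_rim_mass C i (t d : R) : closed C -> cvx C -> t != 0 -> 0 < d ->
  m (deep_rim C (t *: e_ i) d) <= 1600 / s * n%:R * `|t|.
Proof.
move=> clC cvC t0 d0; set v := t *: e_ i; set K := deep_rim C v d.
have mK : msr K by apply: closed_borel; exact: closed_deep_rim.
have n1 : (1 : R) <= n%:R by rewrite ler1n.
have n0' : (0 : R) < n%:R by rewrite ltr0n.
have at0 : 0 < `|t| by rewrite normr_gt0.
pose l : R := (2 * n)%:R^-1.
have l0 : 0 < l by rewrite invr_gt0 ltr0n muln_gt0.
have l2 : l <= 2^-1.
  by rewrite lef_pV2 ?posrE ?ltr0n ?muln_gt0// natrM; lra.
(* The first bound serves the disjointness of the translates, the second makes [n r < 1/200]. *)
pose r : R := Num.min (d / 4) (400 * n%:R)^-1.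
have h400 : 0 < 400 * n%:R :> R by lra.
have r0 : 0 < r by rewrite /r lt_min invr_gt0 h400 andbT divr_gt0.
have rd : 4 * (l * (2 * r)) <= d.
  have : r <= d / 4 by rewrite /r ge_min lexx.
  nra.
have nr : n%:R * r < 200^-1.
  apply: (@le_lt_trans _ _ (n%:R * (400 * n%:R)^-1)).
    by rewrite ler_pM2l// /r ge_min lexx orbT.
  by rewrite (_ : _ * _ = 400^-1); [lra|field; rewrite gt_eqF].
(* The exponent [2 n] cancels [l], leaving the constant [s / 2]; halving [s] absorbs the 1/2 in
   [central_ball_mass]. *)
pose k0 : R := ((s / 2) ^+ n) ^+ 2.
have s2 : 0 < s / 2 by rewrite divr_gt0.
have k00 : 0 < k0 by rewrite !exprn_gt0.
have k0E : k0 `^ l = s / 2.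
  rewrite /k0 -exprM mulnC -powR_mulrn ?(ltW s2)// -powRrM /l divff.
    by rewrite powRr1// ltW.
  by rewrite pnatr_eq0 muln_eq0 /= -lt0n.
have k0_le : k0 <= (s ^+ n) ^+ 2 / 2.
  rewrite /k0 exprMn exprMn ler_wpM2l ?sqr_ge0//.
  have : (2^-1 : R) ^+ n <= 2^-1 by rewrite -[leRHS]expr1 ler_wiXn2l//; lra.
  have : 0 <= (2^-1 : R) ^+ n by rewrite exprn_ge0.
  move: (2^-1 ^+ n) => w; nra.
(* For [k <= M] one has [k |t| <= 1 / (400 n)], and the factor [(1 - l) / l <= 2 n] keeps [z k]
   within 1/200 of the origin. *)
pose M := Num.trunc (400 * n%:R * `|t|)^-1.
have M0 : 0 <= (400 * n%:R * `|t|)^-1 by rewrite invr_ge0; exact: ltW (mulr_gt0 h400 at0).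
have /andP[M1 M2] := truncn_itv M0.
rewrite -/M in M1 M2.
pose z (k : 'I_M.+1) := ((k : nat)%:R * ((1 - l) / l)) *: v.
have zc (k : 'I_M.+1) u : dot u u = 1 -> dot u (z k) <= 200^-1.
  move=> u1; rewrite /z /v !dotZr.
  have -> : dot u (e_ i) = u ord0 i.
    rewrite /dot (bigD1 i)//= big1 => [|j ji]; first by rewrite mxE !eqxx mulr1 addr0.
    by rewrite mxE (negbTE ji) andbF mulr0.
  have ui : `|u ord0 i| <= 1.
    by have := sqr_coord_le u i; rewrite u1 -[u ord0 i ^+ 2]real_normK ?num_real//;
      move: (normr_ge0 (u ord0 i)); nra.
  have kM : (k : nat)%:R <= M%:R :> R by rewrite ler_nat -ltnS ltn_ord.
  have kt : (k : nat)%:R * `|t| <= (400 * n%:R)^-1.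
    apply: (@le_trans _ _ ((400 * n%:R * `|t|)^-1 * `|t|)).
      by rewrite ler_wpM2r// (le_trans kM).
    by rewrite invfM mulfVK ?gt_eqF.
  have ll : 0 <= (1 - l) / l <= 2 * n%:R.
    rewrite divr_ge0/= ?ler_pdivrMr//; [|lra|lra].
    rewrite /l natrM mulfV; first by have := ltW l0; rewrite /l natrM; lra.
    by rewrite mulf_neq0 ?gt_eqF.
  have [w wE] : exists w, w = (1 - l) / l by exists ((1 - l) / l).
  rewrite -wE in ll *; case/andP: ll => w0 wn.
  have tu : `|t * u ord0 i| <= `|t| by rewrite normrM ler_piMr.
  apply: (@le_trans _ _ (2 * n%:R * ((k : nat)%:R * `|t|))).
    rewrite [leLHS](_ : _ = w * ((k : nat)%:R * (t * u ord0 i))); last by ring.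
    apply: (@le_trans _ _ (w * ((k : nat)%:R * `|t|))).
      by rewrite !ler_wpM2l// (le_trans (ler_norm _)).
    by rewrite ler_wpM2r// mulr_ge0.
  apply: (@le_trans _ _ (2 * n%:R * (400 * n%:R)^-1)).
    by rewrite ler_pM2l// mulr_gt0.
  by rewrite (_ : _ * _ = 200^-1)//; field; rewrite gt_eqF.
have lr0 : 0 < l * (2 * r) by rewrite !mulr_gt0.
have S_ge (k : 'I_M.+1) : s / 4 * m K <= m (shrink l (z k) (l * (2 * r)) K).
  have := contraction_mass n0 lc r0 (erefl l) k00 _ mK.
  move=> /(_ (z k)); rewrite k0E => h.
  suff : s / 2 * m K <= 2 * m (shrink l (z k) (l * (2 * r)) K) by lra.
  apply: h => y; apply: le_trans (central_ball_mass lc iso y s0 s10 n0 r0 nr (zc k)).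
  by rewrite ler_wpM2r// mass_ge0.
(* More than [1 / (400 n |t|)] disjoint sets of mass at least [s / 4 * m K] share a total mass 1. *)
have : M.+1%:R * (s / 4 * m K) <= m setT.
  apply: (trivIset_mass_le (F := fun k => shrink l (z k) (l * (2 * r)) K)) => //.
  - by move=> k; exact: measurable_shrink.
  - move=> k k' _ _ [p [kp k'p]]; apply: val_inj => /=.
    have l02 : 0 < l <= 2^-1 by rewrite l0.
    have [lt_k|lt_k|//] := ltngtP k k'; exfalso.
      exact: (deep_rim_shrink_disjoint cvC l02 lr0 rd lt_k kp k'p).
    exact: (deep_rim_shrink_disjoint cvC l02 lr0 rd lt_k k'p kp).
rewrite probability_setT /= => le1.
have mK0 : 0 <= m K by exact: mass_ge0.
have nt0 : 0 < 400 * n%:R * `|t| := mulr_gt0 h400 at0.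
have : (400 * n%:R * `|t|)^-1 * (s / 4 * m K) <= 1.
  apply: le_trans le1; rewrite ler_wpM2r ?(ltW M2)//.
  by rewrite mulr_ge0// divr_ge0 ?(ltW s0).
rewrite ler_pdivrMl// mulr1 => le2.
rewrite -(ler_pM2l s0) (_ : s * (1600 / s * n%:R * `|t|) = 4 * (400 * n%:R * `|t|)).
  lra.
by field; rewrite gt_eqF.
Qed.

(** The bound on deep rims does not depend on [d], so it survives the increasing limit [d -> 0]. *)
Lemma rim_mass C i (t : R) : closed C -> cvx C -> t != 0 ->
  (mu (rim C (t *: e_ i)) <= (1600 / s * n%:R * `|t|)%:E)%E.
Proof.
move=> clC cvC t0; rewrite rim_bigcup_deep//.
pose F k : set (borel_rV R n) := deep_rim C (t *: e_ i) k.+1%:R^-1.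
have mF k : measurable (F k) by apply: closed_borel; exact: closed_deep_rim.
have cF : mu \o F @ \oo --> mu (\bigcup_k F k).
  apply: nondecreasing_cvg_mu => //; first exact: bigcup_measurable.
  move=> k k' kk'; apply/subsetPset => x [Cx h]; split=> // y Cy yx.
  apply: (h y Cy); apply: le_ball yx.
  by rewrite lef_pV2 ?posrE// ler_nat.
rewrite -(cvg_lim _ cF)//; apply: lime_le; first by apply/cvg_ex; eexists; exact: cF.
apply: nearW => k /=; rewrite -[leLHS]fineK ?fin_num_measure// lee_fin.
by apply: deep_rim_mass => //; rewrite invr_gt0.
Qed.

Lemma rims_mass C i e : closed C -> cvx C -> 0 < e ->
  (mu (rim C (e *: e_ i) `|` rim C (- e *: e_ i))
    <= (3200 / s * n%:R * e)%:E)%E.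
Proof.
move=> clC cvC e0; apply: le_trans (measureU2 _ _ _) _; [exact: measurable_rim..|].
have -> : 3200 / s * n%:R * e = 1600 / s * n%:R * `|e| + 1600 / s * n%:R * `|- e|.
  by rewrite normrN gtr0_norm//; field; rewrite gt_eqF.
by rewrite EFinD leeD// rim_mass// ?oppr_eq0 gt_eqF.
Qed.

Lemma boundary_mass C e : closed C -> cvx C -> 0 < e ->
  (mu (C `\` C°) <= (3200 / s * n%:R ^+ 2 * e)%:E)%E.
Proof.
move=> clC cvC e0.
have mrims i : msr (rim C (e *: e_ i) `|` rim C (- e *: e_ i)).
  by apply: measurableU; exact: measurable_rim.
apply: (@le_trans _ _ (mu (\bigcup_(i : 'I_n)
    (rim C (e *: e_ i) `|` rim C (- e *: e_ i))))).
  apply: le_measure; rewrite ?inE.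
  - apply: measurableD; [exact: closed_borel|apply: open_borel].
    exact: open_interior.
  - exact: fin_bigcup_measurable.
  - exact: cvx_sub_interior.
apply: le_trans (measure_finType_bigcup _ mrims) _.
apply: (@le_trans _ _ (\sum_(i < n) (3200 / s * n%:R * e)%:E)%E).
  by apply: lee_sum => i _; exact: rims_mass.
rewrite sumEFin lee_fin sumr_const card_ord -mulr_natr.
by rewrite le_eqVlt; apply/orP; left; apply/eqP; ring.
Qed.

(** Telescoping: each coordinate adds at most one pair of rims of the set already thickened. *)
Lemma thicken_along_mass C e (c : seq 'I_n) : closed C -> cvx C -> 0 < e ->
  (mu (thicken_along C e c `\` C) <= ((size c)%:R * (3200 / s * n%:R * e))%:E)%E.
Proof.
move=> clC cvC e0; elim: c => [|i c IH] /=.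
  by rewrite setDv measure0 mul0r.
set T := thicken_along C e c in IH *.
have clT : closed T by exact: closed_thicken_along.
have cvT : cvx T by exact: cvx_thicken_along.
have clT' : closed (thicken T e i) by exact: closed_thicken.
have cvT' : cvx (thicken T e i) by exact: cvx_thicken.
have mTC : msr (T `\` C) by apply: measurableD; exact: closed_borel.
have mrims : msr (rim (thicken T e i) (e *: e_ i) `|`
    rim (thicken T e i) (- e *: e_ i)).
  by apply: measurableU; exact: measurable_rim.
apply: (@le_trans _ _ (mu ((T `\` C) `|` (rim (thicken T e i) (e *: e_ i) `|`
    rim (thicken T e i) (- e *: e_ i))))).
  apply: le_measure; rewrite ?inE.
  - by apply: measurableD; exact: closed_borel.
  - exact: measurableU.
  - move=> x [Tx nCx]; have [Tx'|nTx'] := pselect (T x); first by left.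
    by right; apply: thicken_setD (ltW e0) _ _.
apply: le_trans (measureU2 _ _ _) _ => //.
rewrite -natr1 mulrDl mul1r EFinD leeD//.
exact: rims_mass.
Qed.

Lemma collar_mass (Q : set 'rV[R]_n) e : cvx Q -> 0 < e ->
  (mu_ext mu (minkowski_sum Q (dilate e (@euclidean_ball R n)) `\` Q)
    <= (6400 / s * n%:R ^+ 2 * e)%:E)%E.
Proof.
move=> cvQ e0.
have clC : closed (closure Q) := @closed_closure _ Q.
have cvC := cvx_closure cvQ.
have m1 : msr (closure Q `\` (closure Q)°).
  by apply: measurableD; [exact: closed_borel|apply: open_borel; exact: open_interior].
have m2 : msr (thicken_along (closure Q) e (enum 'I_n) `\` closure Q).
  by apply: measurableD; apply: closed_borel => //; exact: closed_thicken_along.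
apply: le_trans (le_mu_ext mu (minkowski_setD_sub cvQ e0)) _.
rewrite measurable_mu_extE; last exact: measurableU.
apply: le_trans (measureU2 _ _ _) _ => //.
apply: le_trans (leeD (boundary_mass clC cvC e0)
  (thicken_along_mass (enum 'I_n) clC cvC e0)) _.
rewrite size_enum_ord -EFinD lee_fin le_eqVlt; apply/orP; left; apply/eqP.
by field; rewrite gt_eqF.
Qed.

Lemma Gamma_le : (Gamma mu <= (6400 / s * n%:R ^+ 2)%:E)%E.
Proof.
apply: ge_ereal_sup => _ [Q /convex_set_cvx cvQ <-].
(* The lower limit is a supremum, over the neighbourhoods [V], of infima; any single positive [e] in
   [V] bounds the infimum. *)
rewrite /perimeter limf_einfE; apply: ge_ereal_sup => _ [V FV <-].
have FV0 : nbhs (0 : R)^'+ (V `&` [set e | 0 < e]).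
  by apply: filterI => //; exact: nbhs_right_gt.
have [e [Ve /= e0]] := filter_ex FV0.
apply: le_trans (ereal_inf_lbound _) _; first by exists e.
rewrite lee_pdivrMr// -EFinM.
exact: collar_mass.
Qed.

End RimMass.

Theorem proposition1p4 (R : realType) :
  exists C : R, 0 < C /\
    forall (n : nat), (1 <= n)%N ->
    forall (d : measure_display) (Omega : measurableType d)
      (P : probability Omega R) (X : {RV P >-> borel_rV R n}),
      isotropic (distribution P X) ->
      log_concave (distribution P X) ->
      (Gamma (distribution P X) <= (C * n%:R ^+ 2)%:E)%E.
Proof.
have [s s0 s10] : exists2 s : R, 0 < s & 10 * s <= (100 * 1000)^-1.
  by exists ((100 * 1000)^-1 / 10); lra.
exists (6400 / s); split; first by apply: divr_gt0 s0; lra.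
move=> n n1 d Omega P X iso lc.
have := Gamma_le n1 lc iso s0 s10; exact.
Qed.
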